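(* Let $k$ be an uncountable algebraically closed field, let $A$ be a finitely generated prime left Goldie $k$-algebra of finite Gelfand-Kirillov dimension, and suppose that the centre $Z(A)$ is affine. If $A$ is not strongly cancellative, then $\mathrm{Frac}(Z(A))$ is uniruled over $k$. In particular, if $k$ has characteristic zero and $\mathrm{Frac}(Z(A))$ has nonnegative Kodaira dimension, then $A$ is strongly cancellative.
   Context: Algebras are associative and unital, not necessarily commutative; affine means finitely generated as a $k$-algebra. A $k$-algebra $A$ is strongly cancellative if for every $d\ge 1$ and every $k$-algebra $B$, an isomorphism $A[t_1,\ldots,t_d]\cong B[t_1,\ldots,t_d]$ of $k$-algebras (polynomial rings in commuting central variables) implies $A\cong B$ as $k$-algebras. Since $A$ is prime, $Z(A)$ is an integral domain, and $\mathrm{Frac}(Z(A))$ denotes its field of fractions. For $k$ algebraically closed, a finitely generated field extension $F$ of $k$ is uniruled over $k$ if there is a finitely generated field extension $E$ of $k$ with $\mathrm{trdeg}_k(E)=\mathrm{trdeg}_k(F)-1$ and an injective $k$-algebra homomorphism $F\to E(t)$, where $E(t)$ is the rational function field in one variable. The Kodaira dimension of $F$ is the Kodaira dimension of a normal projective scheme $X$ of finite type over $k$ with function field $F$ (this is well defined since Kodaira dimension is a birational invariant). *)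

(* Defs.v *)
From HB Require Import structures.
From mathcomp Require Import all_boot all_algebra.
From mathcomp Require Import all_classical all_reals all_analysis.
(* The notations of mpoly clash with those of mathcomp-analysis. *)
From mathcomp Require Export -(notations) mpoly.

Set Implicit Arguments.
Unset Strict Implicit.
Unset Printing Implicit Defensive.

Import GRing.Theory.
Local Open Scope classical_set_scope.
Local Open Scope ring_scope.

Section Algebras.
Variable k : fieldType.

Definition fg_algebra (A : algType k) : Prop :=
  exists s : seq A, forall S : {pred A},
    GRing.subalg_closed S -> {subset s <= S} -> forall a : A, a \in S.

Definition alg_isomorphic (A B : algType k) : Prop :=
  exists f : {lrmorphism A -> B}, bijective f.

(* [mpoly d A] is only equipped with an [A]-algebra structure, so
   [k]-linearity of a ring morphism is expressed on the scalars [c%:A]. *)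
Definition poly_alg_isomorphic (d : nat) (A B : algType k) : Prop :=
  exists2 f : {rmorphism mpoly d A -> mpoly d B}, bijective f &
    forall c : k, f (mpolyC d c%:A) = mpolyC d c%:A.

Definition strongly_cancellative (A : algType k) : Prop :=
  forall (d : nat) (B : algType k), (1 <= d)%N ->
    poly_alg_isomorphic d A B -> alg_isomorphic A B.

Section RingConditions.
Variable A : algType k.

Definition left_ideal (I : set A) : Prop :=
  [/\ I 0, forall x y, I x -> I y -> I (x + y) & forall a x, I x -> I (a * x)].

Definition two_sided_ideal (I : set A) : Prop :=
  left_ideal I /\ forall x a, I x -> I (x * a).

(* [A <> 0] is built into [algType]. *)
Definition prime_algebra : Prop :=
  forall I J : set A, two_sided_ideal I -> two_sided_ideal J ->
    (forall x y, I x -> J y -> x * y = 0) -> I = [set 0] \/ J = [set 0].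

Definition left_annihilator (S : set A) : set A :=
  [set a | forall s, S s -> a * s = 0].

Definition acc_left_annihilators : Prop :=
  forall S : nat -> set A,
    (forall n, left_annihilator (S n) `<=` left_annihilator (S n.+1)) ->
    exists N, forall n, (N <= n)%N ->
      left_annihilator (S n) = left_annihilator (S N).

Definition independent_left_ideals (I : nat -> set A) : Prop :=
  forall (N : nat) (x : nat -> A), (forall n, I n (x n)) ->
    \sum_(n < N) x n = 0 -> forall n, (n < N)%N -> x n = 0.

Definition left_goldie : Prop :=
  acc_left_annihilators /\
  ~ exists I : nat -> set A,
      [/\ forall n, left_ideal (I n), forall n, I n <> [set 0]
        & independent_left_ideals I].

Definition lin_indep_on (I : finType) (v : I -> A) (J : {set I}) : Prop :=
  forall c : I -> k, \sum_(i in J) c i *: v i = 0 ->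
    forall i, i \in J -> c i = 0.

Definition span_dim (I : finType) (v : I -> A) : nat :=
  (\max_(J : {set I} | `[< lin_indep_on v J >]) #|J|)%N.

(* dim V^n, where V is spanned by 1 and s *)
Definition growth (s : seq A) (n : nat) : nat :=
  span_dim (fun w : {ffun 'I_n -> 'I_(size (1 :: s))} =>
              \prod_(j < n) (1 :: s)`_(w j)).

Definition GKdim (R : realType) : \bar R :=
  ereal_sup [set limn_esup (fun n => (ln (growth s n)%:R / ln n%:R)%:E)
            | s in [set: seq A]].

Definition centre : {pred A} := fun z => `[< forall a, z * a = a * z >].

Fact centre_subalg : GRing.subalg_closed centre.
Proof.
split.
- by apply/asboolP => a; rewrite mul1r mulr1.
- move=> c x y /asboolP hx /asboolP hy; apply/asboolP => a.
  by rewrite mulrDl mulrDr -scalerAl -scalerAr hx hy.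
- move=> x y /asboolP hx /asboolP hy; apply/asboolP => a.
  by rewrite -mulrA hy !mulrA hx.
Qed.

HB.instance Definition _ := GRing.isSubalgClosed.Build k A centre centre_subalg.

Definition centre_alg : Type := {z : A | z \in centre}.
HB.instance Definition _ := [isSub of centre_alg for (@sval A (fun z => z \in centre))].
HB.instance Definition _ := [Choice of centre_alg by <:].
HB.instance Definition _ := [SubChoice_isSubAlgebra of centre_alg by <:].

Fact centre_mulC : commutative (@GRing.mul centre_alg).
Proof.
move=> x y; apply/val_inj; rewrite !rmorphM /=.
by have /asboolP -> := valP x.
Qed.
HB.instance Definition _ := GRing.PzRing_hasCommutativeMul.Build centre_alg centre_mulC.

End RingConditions.

(* The centre of a prime algebra, as an integral domain. *)
Section CentreDomain.
Variables (A : algType k) (hA : prime_algebra A).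

Definition centre_domain of prime_algebra A : Type := centre_alg A.
Local Notation Z := (centre_domain hA).

HB.instance Definition _ := GRing.ComNzRing.on Z.
HB.instance Definition _ := GRing.Algebra.on Z.

Definition centre_unit : {pred Z} := fun x => `[< exists y : Z, y * x = 1 >].
Definition centre_inv (x : Z) : Z :=
  if pselect (exists y : Z, y * x = 1) is left e then projT1 (cid e) else x.

Fact centre_mulVr : {in centre_unit, left_inverse 1 centre_inv *%R}.
Proof.
move=> x /asboolP hx; rewrite /centre_inv; case: pselect => // e.
by case: (cid e).
Qed.
Fact centre_unitP (x y : Z) : y * x = 1 -> x \in centre_unit.
Proof. by move=> h; apply/asboolP; exists y. Qed.
Fact centre_inv_out : {in [predC centre_unit], centre_inv =1 id}.
Proof.
move=> x; rewrite inE => /asboolP hx; rewrite /centre_inv.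
by case: pselect.
Qed.
HB.instance Definition _ :=
  GRing.ComNzRing_hasMulInverse.Build Z centre_mulVr centre_unitP centre_inv_out.

Fact centre_integral (x y : centre_alg A) : x * y = 0 -> (x == 0) || (y == 0).
Proof.
move=> xy0.
have zC (z : centre_alg A) a : val z * a = a * val z by have /asboolP := valP z.
pose I (z : centre_alg A) := [set a | exists b, a = b * val z].
have idI z : two_sided_ideal (I z).
  split; first split.
  - by exists 0; rewrite mul0r.
  - by move=> _ _ [a ->] [b ->]; exists (a + b); rewrite mulrDl.
  - by move=> a _ [b ->]; exists (a * b); rewrite mulrA.
  - by move=> _ a [b ->]; exists (b * a); rewrite -!mulrA zC.
have I0 z : I z = [set 0] -> z == 0.
  move=> e; apply/eqP/val_inj; rewrite [RHS]raddf0.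
  have : I z (val z) by exists 1; rewrite mul1r.
  by rewrite e.
apply/orP; have [||] := hA (idI x) (idI y); [|by left; apply: I0|by right; apply: I0].
move=> _ _ [a ->] [b ->].
rewrite mulrA -(mulrA a) zC mulrA -mulrA.
have vxy : val x * val y = 0 by rewrite -rmorphM xy0 raddf0.
by rewrite vxy mulr0.
Qed.
HB.instance Definition _ := GRing.ComUnitRing_isIntegral.Build Z centre_integral.

Definition frac_centre : fieldType := {fraction Z}.

Definition frac_centre_scalar : {rmorphism k -> frac_centre} :=
  @tofrac Z \o in_alg Z.

End CentreDomain.
End Algebras.

(* An extension of k is a field F with a ring morphism i : k -> F. *)
Section FieldExtensions.
Variable k : fieldType.

Definition fg_extension (F : fieldType) (i : {rmorphism k -> F}) : Prop :=
  exists s : seq F, forall S : {pred F},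
    GRing.divring_closed S -> (forall c, i c \in S) -> {subset s <= S} ->
    forall y : F, y \in S.

Definition alg_indep (F : fieldType) (i : {rmorphism k -> F}) (n : nat)
    (x : n.-tuple F) : Prop :=
  forall p : mpoly n k, mmap i (tnth x) p = 0 -> p = 0.

Definition has_trdeg (F : fieldType) (i : {rmorphism k -> F}) (n : nat) : Prop :=
  exists2 x : n.-tuple F,
    alg_indep i x & forall y : F, ~ alg_indep i [tuple of y :: x].

Definition rational_functions (E : fieldType) : fieldType :=
  {fraction {poly E}}.

Definition rational_const (E : fieldType) :
    {rmorphism E -> rational_functions E} :=
  @tofrac {poly E} \o polyC.

Definition uniruled (F : fieldType) (i : {rmorphism k -> F}) : Prop :=
  exists (E : fieldType) (j : {rmorphism k -> E}) (n : nat),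
    [/\ fg_extension j, has_trdeg j n, has_trdeg i n.+1
      & exists2 f : {rmorphism F -> rational_functions E}, injective f &
          forall c : k, f (i c) = rational_const E (j c)].

End FieldExtensions.

(* Integral projective schemes X over an algebraically closed field k with
   function field F are encoded by their generic point: a closed embedding of
   X in P^N amounts to homogeneous coordinates x_0, ..., x_N in F, not all
   zero, whose degree 0 fractions exhaust F; the homogeneous ideal of X is then
   the set of polynomials whose homogeneous components vanish at x. *)
Section ProjectiveModels.
Variables (k : closedFieldType) (F : fieldType) (i : {rmorphism k -> F}).

Definition homogeneous (N d : nat) (p : mpoly N k) : Prop := p \is ishomog1 d mdeg.

Section Model.
Variables (N : nat) (x : 'I_N.+1 -> F).

Definition projective_model : Prop :=
  (exists j, x j != 0) /\
  forall y : F, exists (d : nat) (g h : mpoly N.+1 k),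
    [/\ homogeneous d g, homogeneous d h, mmap i x h != 0
      & y = mmap i x g / mmap i x h].

Definition closed_point (P : 'I_N.+1 -> k) : Prop :=
  (exists j, P j != 0) /\
  forall (d : nat) (g : mpoly N.+1 k),
    homogeneous d g -> mmap i x g = 0 -> meval P g = 0.

Definition local_ring (P : 'I_N.+1 -> k) : set F :=
  [set y | exists (d : nat) (g h : mpoly N.+1 k),
    [/\ homogeneous d g, homogeneous d h, meval P h != 0
      & y = mmap i x g / mmap i x h]].

Definition local_maximal_ideal (P : 'I_N.+1 -> k) : set F :=
  [set y | exists (d : nat) (g h : mpoly N.+1 k),
    [/\ homogeneous d g, homogeneous d h, meval P h != 0, meval P g = 0
      & y = mmap i x g / mmap i x h]].

(* The local ring at a closed point of X has dimension n = trdeg_k F; it is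
   regular when its maximal ideal has n generators. *)
Definition regular_point (n : nat) (P : 'I_N.+1 -> k) : Prop :=
  exists2 u : 'I_n -> F, forall l, local_maximal_ideal P (u l) &
    forall y, local_maximal_ideal P y ->
      exists2 c : 'I_n -> F, forall l, local_ring P (c l)
                           & y = \sum_l c l * u l.

Definition smooth_projective_model (n : nat) : Prop :=
  projective_model /\ forall P, closed_point P -> regular_point n P.

End Model.

Record derivation := Derivation {
  der_fun :> F -> F;
  der_add : forall a b, der_fun (a + b) = der_fun a + der_fun b;
  der_mul : forall a b, der_fun (a * b) = a * der_fun b + b * der_fun a;
  der_scalar : forall c : k, der_fun (i c) = 0 }.

(* da_1 /\ ... /\ da_n evaluated at n derivations; Der_k(F) is the dual of
   Omega_{F/k}, so for n = trdeg_k F (and F/k separable) such functions span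
   the line Omega^n_{F/k}. *)
Definition wedge_diff (n : nat) (a : 'I_n -> F) (D : 'I_n -> derivation) : F :=
  \det (\matrix_(p < n, q < n) D p (a q)).

(* Elements of the m-th tensor power of the line Omega^n_{F/k} are identified
   with degree m homogeneous functions on its dual line, the n-th exterior
   power of Der_k(F). *)
Definition rational_form (n : nat) : Type := ('I_n -> derivation) -> F.

(* The image of the m-th tensor power of Omega^n_{O/k}, for a subring O. *)
Definition regular_over (O : set F) (n m : nat) (w : rational_form n) : Prop :=
  exists (r : nat) (f : 'I_r -> F) (a : 'I_r -> 'I_m -> 'I_n -> F),
    [/\ forall l, O (f l), forall l j q, O (a l j q)
      & forall D, w D = \sum_(l < r) f l * \prod_(j < m) wedge_diff (a l j) D].

Section Kodaira.
Variables (n N : nat) (x : 'I_N.+1 -> F).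

(* w is in H^0(X, omega_X^m) *)
Definition pluricanonical (m : nat) (w : rational_form n) : Prop :=
  forall P, closed_point x P -> regular_over (local_ring x P) m w.

(* The quotients y = w / w' of sections of omega_X^m generate the function
   field of the image of the m-th pluricanonical map. *)
Definition pluricanonical_ratio (m : nat) (y : F) : Prop :=
  exists w w' : rational_form n,
    [/\ pluricanonical m w, pluricanonical m w', exists D, w' D != 0
      & forall D, w D = y * w' D].

(* For some m > 0, H^0(X, omega_X^m) <> 0 and the image of the m-th
   pluricanonical map has dimension at least d. *)
Definition pluricanonical_image_dim_ge (d : nat) : Prop :=
  exists m : nat,
    [/\ (0 < m)%N,
        exists w : rational_form n, pluricanonical m w /\ exists D, w D != 0
      & exists y : d.-tuple F,
          alg_indep i y /\ forall l, pluricanonical_ratio m (tnth y l)].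

(* None stands for -oo *)
Definition model_kodaira_dim (kappa : option nat) : Prop :=
  if kappa is Some d then
    pluricanonical_image_dim_ge d /\ ~ pluricanonical_image_dim_ge d.+1
  else ~ exists d, pluricanonical_image_dim_ge d.

End Kodaira.

(* The Kodaira dimension of a singular normal projective X is by definition
   that of a smooth projective variety birational to X, that is, with the same
   function field; the sections of multiples of K_X on X itself would not give
   a birational invariant. *)
Definition kodaira_dim (kappa : option nat) : Prop :=
  exists (n N : nat) (x : 'I_N.+1 -> F),
    [/\ has_trdeg i n, smooth_projective_model x n
      & model_kodaira_dim n x kappa].

Definition nonneg_kodaira_dim : Prop := exists d : nat, kodaira_dim (Some d).

End ProjectiveModels.

(* Main.v *)
Require Import Defs.
From HB Require Import structures.
From mathcomp Require Import all_boot all_algebra all_field perm.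
From mathcomp Require Import all_classical all_reals all_analysis.
From mathcomp Require Import ring zify.

Set Implicit Arguments.
Unset Strict Implicit.
Unset Printing Implicit Defensive.

Import GRing.Theory.
Local Open Scope ring_scope.

(** Let [f] be an isomorphism from [A[t_1, ..., t_d]] to [B[s_1, ..., s_d]]. It
    restricts to an isomorphism [g] between the polynomial rings [Z[t]] and [S[s]]
    over the centres [Z] of [A] and [S] of [B] (lemma [centre_rmorph]), and [Z] is
    an affine domain. Everything depends on whether [g] maps [Z] into [S].

    If it does, then [S] equals [Z] inside this ring (lemma [constants_onto]).
    Indeed [t = 0] defines a retraction of [S] onto [Z]. An element [u] of its
    kernel is algebraic over [Z[s]], because the polynomial ring has transcendence
    degree [d] over [Z]. The retraction, extended to [S[s]], does not affect the
    [s_j]; as these are independent, it cannot kill [u] unless [u = 0]. Once the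
    centres agree, [A] and [B] are both obtained from the same algebra by giving
    the same central values to the [t_j], hence isomorphic ([cancel_same_centre]).

    If some [g r0] with [r0] in [Z] involves the [s_j], then the points of
    [Spec Z] move along the lines of the affine spaces over [Spec S]. A general
    line through the image of a general section [t = lam] gives a morphism
    [theta : Z -> Z[X]] which is the identity at [X = 0], while [theta r0] is not
    constant (lemmas [deform0] and [ex_deform]). Take a general constant [c] and
    a component of the divisor [r0 = c]. Its function field [E] has one dimension
    less, and the deformation moves the divisor off itself, so that
    [Z -> E[X]] is injective: [Frac Z] is uniruled ([deformation_uniruled]). The
    component is produced by elimination, in the theorem [specialization]: a
    morphism from a ring [D] to a field extends to finitely many further elements
    as soon as some element [u != 0] of [D] is not killed; values of algebraic
    elements are roots of their specialized minimal relations.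

    In characteristic zero a uniruled field has no nonzero pluricanonical form
    ([no_pluricanonical_form]), hence no nonnegative Kodaira dimension. Let
    [F -> E(t)] be an embedding of the function field of a smooth model, both of
    transcendence degree [n]. Derivations of [F] are determined by a transcendence
    basis, so that a form [w] of weight [m] can be evaluated on the frame of
    [E(t)] made of [d/dt] and of the partial derivatives on [E]; the value [W] is
    nonzero if [w] is. Every place of the line over [E] is mapped to a point of
    the model that specializes to a closed point ([place_closed_point]), near which
    [w] is a sum of products of regular functions and of their differentials.
    Therefore [W] has no poles and is a polynomial in [t] ([pullback_polynomial]).
    The same holds for the coordinate [1 / t], whose derivation is
    [- t ^ 2 d/dt]: then [(- t ^ 2) ^ m W] is a polynomial in [1 / t], which is
    absurd for degree reasons ([no_form_on_line]). *)

Local Notation mvar i := (mpolyX _ (mnm1 i)).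

(** * Ring morphisms and fractions *)

(** All ring morphisms whose values have to be chosen (on fractions, on centres,
    on subrings) are obtained from their graph. *)
Lemma rmorph_of_graph (A B : nzRingType) (G : A -> B -> Prop) :
  (forall a, exists b, G a b) -> (forall b, G 0 b -> b = 0) -> G 1 1 ->
  (forall a b a' b', G a b -> G a' b' -> G (a - a') (b - b')) ->
  (forall a b a' b', G a b -> G a' b' -> G (a * a') (b * b')) ->
  exists g : {rmorphism A -> B}, forall a, G a (g a).
Proof.
move=> Gtot G0 G1 GB GM.
pose g a := projT1 (cid (Gtot a)).
have gP a : G a (g a) by rewrite /g; case: cid.
have Gfun a b : G a b -> b = g a.
  move=> Gab; apply/eqP; rewrite -subr_eq0; apply/eqP/G0.
  by rewrite -(subrr a); apply: GB.
have gB : zmod_morphism g by move=> a b; apply/esym/Gfun/GB.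
have gM : monoid_morphism g.
  by split=> [|a b]; apply/esym/Gfun => //; apply: GM.
pose gA := GRing.isZmodMorphism.Build _ _ g gB.
pose gMM := GRing.isMonoidMorphism.Build _ _ g gM.
pose h : {rmorphism A -> B} := HB.pack g gA gMM.
by exists h.
Qed.

Lemma frac_div (R : idomainType) (x : {fraction R}) :
  exists a b : R, b != 0 /\ x = tofrac a / tofrac b.
Proof.
elim/quotW: x => r; have d0 := denom_ratioP r.
exists (val r).1, (val r).2; split=> //.
apply: (@mulIf _ (tofrac (val r).2)); rewrite ?tofrac_eq0 // divfK ?tofrac_eq0 //.
unlock FracField.tofrac; rewrite -[LHS]FracField.pi_mul; apply/eqmodP.
rewrite /= FracField.equivfE /FracField.mulf /= !numden_Ratio ?mulf_neq0 ?oner_eq0 //.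
by rewrite !mulr1 mulrC.
Qed.

Lemma subf_div (K : fieldType) (a b c d : K) : b != 0 -> d != 0 ->
  a / b - c / d = (a * d - c * b) / (b * d).
Proof. by move=> b0 d0; rewrite -mulNr addf_div // mulNr. Qed.

Lemma frac_rmorph (R : idomainType) (K : fieldType) (h : {rmorphism R -> K}) :
  (forall a, h a = 0 -> a = 0) ->
  exists g : {rmorphism {fraction R} -> K}, forall a, g (tofrac a) = h a.
Proof.
move=> h0.
have hn a : a != 0 -> h a != 0 by apply: contra_neq => /h0.
have fn (a : R) : a != 0 -> tofrac a != 0 by rewrite tofrac_eq0.
pose G (x : {fraction R}) y := exists a b, [/\ b != 0, x = tofrac a / tofrac b & y = h a / h b].
have [g gP] : exists g : {rmorphism {fraction R} -> K}, forall x, G x (g x).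
  apply: rmorph_of_graph.
  - by move=> x; have [a [b [b0 ->]]] := frac_div x; exists (h a / h b), a, b.
  - move=> _ [a [b [b0 /esym/eqP + ->]]].
    by rewrite mulf_eq0 invr_eq0 (negPf (fn _ b0)) orbF tofrac_eq0 => /eqP->;
       rewrite rmorph0 mul0r.
  - by exists 1, 1; rewrite !rmorph1 !divr1 oner_neq0.
  - move=> _ _ _ _ [a [b [b0 -> ->]]] [c [d [d0 -> ->]]].
    exists (a * d - c * b), (b * d); rewrite mulf_neq0 // !rmorphB !rmorphM.
    by split=> //; rewrite subf_div ?fn ?hn.
  - move=> _ _ _ _ [a [b [b0 -> ->]]] [c [d [d0 -> ->]]].
    exists (a * c), (b * d); rewrite mulf_neq0 // !rmorphM.
    by split=> //; rewrite mulf_div.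
exists g => a; have [c [d [d0 e ->]]] := gP (tofrac a).
have : tofrac c = tofrac (a * d) by rewrite [RHS]tofracM e divfK ?fn.
by move/eqP; rewrite tofrac_eq => /eqP ->; rewrite rmorphM mulfK ?hn.
Qed.

Lemma ex_root_extension (K : fieldType) (p : {poly K}) : (1 < size p)%N ->
  exists (L : fieldType) (i : {rmorphism K -> L}) (z : L), root (map_poly i p) z.
Proof.
have [n] := ubnP (size p); elim: n p => // n IHn p ltpn p1.
have [[d [/andP[d1 dp] /dvdpP[q pq]]]|irr] :=
    pselect (exists d : {poly K}, (1 < size d < size p)%N /\ d %| p).
  have [L [i [z dz]]] := IHn d (leq_trans dp (ltpn : (size p <= n)%N)) d1.
  by exists L, i, z; rewrite pq rmorphM rootM dz orbT.
have pI : irreducible_poly p.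
  split=> // q q1 qp; rewrite -dvdp_size_eqp //; apply/eqP; apply: contrapT => sq.
  have p0 : p != 0 by rewrite -size_poly_gt0 ltnW.
  have q0 : q != 0 by apply: contraNneq p0 => q0; rewrite q0 dvd0p in qp.
  apply: irr; exists q; split=> //.
  rewrite ltn_neqAle eq_sym q1 size_poly_gt0 q0 /= ltn_neqAle dvdp_leq // andbT.
  by apply/eqP.
have [L _ [z pz _]] := irredp_FAdjoin pI.
by exists L, (in_alg L), z.
Qed.

Lemma mpoly_rmorph_ext (n : nat) (R S : nzRingType)
    (f g : {rmorphism mpoly n R -> S}) :
  (forall c, f (mpolyC n c) = g (mpolyC n c)) ->
  (forall i, f (mvar i) = g (mvar i)) -> f =1 g.
Proof.
move=> fgC fgX p; elim/mpolyind: p => [|c m p _ _ IH]; first by rewrite !rmorph0.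
rewrite !rmorphD IH -mul_mpolyC !rmorphM fgC; congr (_ * _ + _).
rewrite mpolyXE_id !rmorph_prod; apply: eq_bigr => i _.
by rewrite !rmorphXn fgX.
Qed.

Lemma poly_rmorph_ext (R S : nzRingType) (f g : {rmorphism {poly R} -> S}) :
  (forall c, f c%:P = g c%:P) -> f 'X = g 'X -> f =1 g.
Proof.
move=> fgC fgX p; elim/poly_ind: p => [|p c IH]; first by rewrite !rmorph0.
by rewrite !rmorphD !rmorphM IH fgC fgX.
Qed.

(** As a rewriting rule this keeps [f] and [g] folded, while simplification would
    also unfold them when they are defined as evaluations. *)
Lemma rmorph_compE (A B C : nzRingType) (f : {rmorphism B -> C})
    (g : {rmorphism A -> B}) (a : A) : (f \o g : {rmorphism A -> C}) a = f (g a).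
Proof. by []. Qed.

Section MmapRules.
Variables (n : nat) (R S : comNzRingType) (f : {rmorphism R -> S}) (h : 'I_n -> S).

Lemma mmap_constE c : (mmap f h : {rmorphism mpoly n R -> S}) (mpolyC n c) = f c.
Proof. exact: mmapC. Qed.

Lemma mmap_varE l : (mmap f h : {rmorphism mpoly n R -> S}) (mvar l) = h l.
Proof. by rewrite /= mmapX mmap1U. Qed.

End MmapRules.

Section EvalPoly.
Variables (A B : nzRingType) (C : comNzRingType).

Definition eval_poly (f : {rmorphism A -> C}) (z : C) : {rmorphism {poly A} -> C} :=
  horner_morph (fun a => mulrC z (f a)).

Lemma eval_polyE f z p : eval_poly f z p = (map_poly f p).[z].
Proof. by []. Qed.

Lemma eval_polyC f z c : eval_poly f z c%:P = f c.
Proof. by rewrite eval_polyE map_polyC hornerC. Qed.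

Lemma eval_polyX f z : eval_poly f z 'X = z.
Proof. by rewrite eval_polyE map_polyX hornerX. Qed.

End EvalPoly.

Section MpolyCons.
Variables (n : nat) (R : comNzRingType).

(** [mpoly n.+1 R] is identified with the polynomials over [mpoly n R] in the
    indeterminate of index 0, so that algebraic independence can be studied one
    element at a time. *)
Definition mcons_val (i : 'I_n.+1) : {poly mpoly n R} :=
  if unlift ord0 i is Some j then (mvar j)%:P else 'X.
Definition mcons : {rmorphism mpoly n.+1 R -> {poly mpoly n R}} :=
  mmap (polyC \o @mpolyC n R) mcons_val.
Definition mshift : {rmorphism mpoly n R -> mpoly n.+1 R} :=
  mmap (@mpolyC n.+1 R) (fun j => mvar (lift ord0 j)).
Definition muncons : {rmorphism {poly mpoly n R} -> mpoly n.+1 R} :=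
  eval_poly mshift (mvar ord0).

Lemma mconsC c : mcons (mpolyC _ c) = (mpolyC _ c)%:P.
Proof. by rewrite /mcons /= mmapC. Qed.
Lemma mcons0 : mcons (mvar ord0) = 'X.
Proof. by rewrite /mcons /= mmapX mmap1U /mcons_val unlift_none. Qed.
Lemma mconsS j : mcons (mvar (lift ord0 j)) = (mvar j)%:P.
Proof. by rewrite /mcons /= mmapX mmap1U /mcons_val liftK. Qed.
Lemma mshiftC c : mshift (mpolyC _ c) = mpolyC _ c.
Proof. by rewrite /mshift /= mmapC. Qed.
Lemma mshiftX j : mshift (mvar j) = mvar (lift ord0 j).
Proof. by rewrite /mshift /= mmapX mmap1U. Qed.

Lemma mconsK : cancel mcons muncons.
Proof.
apply: (mpoly_rmorph_ext (f := muncons \o mcons) (g := idfun)) => [c|i].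
  by rewrite rmorph_compE mconsC eval_polyC mshiftC.
rewrite rmorph_compE; case: (unliftP ord0 i) => [j|] ->.
  by rewrite mconsS eval_polyC mshiftX.
by rewrite mcons0 eval_polyX.
Qed.

Lemma munconsK : cancel muncons mcons.
Proof.
apply: (poly_rmorph_ext (f := mcons \o muncons) (g := idfun)) => [p|]; last first.
  by rewrite rmorph_compE eval_polyX mcons0.
rewrite rmorph_compE eval_polyC -rmorph_compE.
apply: (mpoly_rmorph_ext (f := mcons \o mshift) (g := polyC)) => [c|i].
  by rewrite rmorph_compE mshiftC mconsC.
by rewrite rmorph_compE mshiftX mconsS.
Qed.

Lemma mmap_mcons (S : comNzRingType) (f : {rmorphism R -> S}) (h : 'I_n.+1 -> S) p :
  mmap f h p = eval_poly (mmap f (fun j => h (lift ord0 j))) (h ord0) (mcons p).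
Proof.
rewrite -rmorph_compE; move: p; apply: (mpoly_rmorph_ext (f := mmap f h)) => [c|i].
  by rewrite rmorph_compE mconsC eval_polyC /= !mmapC.
rewrite rmorph_compE; case: (unliftP ord0 i) => [j|] ->.
  by rewrite mconsS eval_polyC /= !mmapX !mmap1U.
by rewrite mcons0 eval_polyX /= !mmapX !mmap1U.
Qed.

End MpolyCons.
Arguments mcons {n R}.
Arguments mshift {n R}.
Arguments muncons {n R}.

(** * Algebraic dependence *)

Section Subfield.
Variables (M : fieldType) (S : {pred M}) (hS : GRing.divring_closed S).

Definition subfield_pred of GRing.divring_closed S : {pred M} := S.
HB.instance Definition _ := GRing.isDivringClosed.Build M (subfield_pred hS) hS.
Definition subfield := {x : M | x \in subfield_pred hS}.
HB.instance Definition _ :=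
  [isSub of subfield for (@sval M (fun x => x \in subfield_pred hS))].
HB.instance Definition _ := [Choice of subfield by <:].
HB.instance Definition _ := [SubChoice_isSubIntegralDomain of subfield by <:].
HB.instance Definition _ := [SubIntegralDomain_isSubField of subfield by <:].
End Subfield.

Lemma ex_subfield (M : fieldType) (S : {pred M}) : GRing.divring_closed S ->
  exists (K : fieldType) (i : {rmorphism K -> M}),
    forall a, a \in S <-> exists x, a = i x.
Proof.
move=> hS; exists (subfield hS), (val : {rmorphism subfield hS -> M}) => a.
split=> [aS|[x ->]]; last exact: (valP x).
by exists (Sub a aS).
Qed.

Section Fractions.
Variables (D : comNzRingType) (M : fieldType) (s : {rmorphism D -> M}).

Definition fractions : {pred M} :=
  fun a => `[< exists p q, s q != 0 /\ a = s p / s q >].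

Lemma fractionsP a :
  reflect (exists p q, s q != 0 /\ a = s p / s q) (a \in fractions).
Proof. exact: asboolP. Qed.

Lemma fractions_image d : s d \in fractions.
Proof. by apply/fractionsP; exists d, 1; rewrite rmorph1 oner_neq0 divr1. Qed.

Lemma fractions_divring : GRing.divring_closed fractions.
Proof.
split.
- by rewrite -(rmorph1 s) fractions_image.
- move=> _ _ /fractionsP[p [q [q0 ->]]] /fractionsP[p' [q' [q0' ->]]].
  apply/fractionsP; exists (p * q' - p' * q), (q * q').
  by rewrite rmorphB !rmorphM mulf_neq0 // subf_div.
- move=> _ _ /fractionsP[p [q [q0 ->]]] /fractionsP[p' [q' [q0' ->]]].
  have [p0'|p0'] := eqVneq (s p') 0.
    by apply/fractionsP; exists 0, 1; rewrite rmorph1 oner_neq0 p0' mul0r invr0 mulr0 rmorph0 mul0r.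
  apply/fractionsP; exists (p * q'), (q * p').
  by rewrite !rmorphM mulf_neq0 // invf_div mulf_div.
Qed.

Lemma fractions_min (S : {pred M}) : GRing.divring_closed S ->
  (forall d, s d \in S) -> {subset fractions <= S}.
Proof.
by case=> _ _ Sd sS _ /fractionsP[p [q [q0 ->]]]; apply: Sd.
Qed.

(** Common denominators turn algebraicity over the fractions, where the theory of
    field extensions applies, into polynomial relations over [D]. *)
Lemma clear_denominators (p : {poly M}) : (forall j, p`_j \in fractions) ->
  exists (q : D) (P : {poly D}), s q != 0 /\ map_poly s P = s q *: p.
Proof.
elim/poly_ind: p => [|p c IHp] cf.
  by exists 1, 0; rewrite rmorph1 oner_neq0 rmorph0 scaler0.
have pf j : p`_j \in fractions.
  by move: (cf j.+1); rewrite coefD coefMX coefC addr0.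
have /fractionsP[a [b [b0 ec]]] : c \in fractions.
  by move: (cf 0%N); rewrite coefD coefMX coefC add0r.
have [q [P [q0 eP]]] := IHp pf.
exists (q * b), ((b *: P) * 'X + (q * a)%:P).
have -> : map_poly s (b *: P * 'X + (q * a)%:P) = s b *: map_poly s P * 'X + (s q * s a)%:P.
  by rewrite rmorphD rmorphM /= map_polyX map_polyC map_polyZ /= rmorphM.
rewrite rmorphM mulf_neq0 //; split=> //.
rewrite eP ec scalerDr scalerA scalerAl (mulrC (s b)); congr (_ + _).
by rewrite -mul_polyC -polyCM -mulrA [s b * _]mulrC divfK.
Qed.

(** The condition bears on [map_poly s P] because [s] may have a kernel: the rings
    [D] below are polynomial rings that present subrings of [M]. *)
Definition algebraic (a : M) : Prop :=
  exists2 P : {poly D}, map_poly s P != 0 & eval_poly s a P = 0.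

Lemma poly_lift (K : nzRingType) (i : {rmorphism K -> M}) (p : {poly M}) :
  (forall j, exists x, p`_j = i x) -> exists q, map_poly i q = p.
Proof.
move=> h; exists (\poly_(j < size p) projT1 (cid (h j))); apply/polyP => j.
rewrite coef_map coef_poly; case: ltnP => jp; first by case: cid.
by rewrite (nth_default 0 jp); apply: raddf0.
Qed.

Lemma algebraicE (K : fieldType) (i : {rmorphism K -> M}) a :
  (forall a, a \in fractions <-> exists x, a = i x) ->
  algebraic a <-> algebraicOver i a.
Proof.
move=> iP; split=> [[P P0 Pa]|[p p0 pa]].
  have [q eq] : exists q, map_poly i q = map_poly s P.
    by apply: poly_lift => j; rewrite coef_map; apply/iP/fractions_image.
  exists q; last by rewrite /root eq; apply/eqP.
  by apply: contraNneq P0 => q0; rewrite -eq q0 rmorph0.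
have [q [P [q0 eP]]] : exists (q : D) (P : {poly D}), s q != 0 /\ map_poly s P = s q *: map_poly i p.
  by apply: clear_denominators => j; rewrite coef_map; apply/iP; eexists.
exists P; first by rewrite eP scaler_eq0 negb_or q0 map_poly_eq0.
by rewrite eval_polyE eP hornerZ (eqP pa) mulr0.
Qed.

Lemma algebraic_image d : algebraic (s d).
Proof.
exists ('X - d%:P); rewrite ?rmorphB /= ?eval_polyX ?eval_polyC ?subrr //.
by rewrite map_polyX map_polyC polyXsubC_eq0.
Qed.

Lemma algebraic_divring : GRing.divring_closed (fun a => `[< algebraic a >]).
Proof.
have [K [i iP]] := ex_subfield fractions_divring.
have aE a := algebraicE a iP.
split.
- by apply/asboolP; rewrite -(rmorph1 s); apply: algebraic_image.
- move=> a b /asboolP/aE aa /asboolP/aE ab; apply/asboolP/aE.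
  exact: algebraic_sub.
- move=> a b /asboolP/aE aa /asboolP/aE ab; apply/asboolP/aE.
  exact: algebraic_div.
Qed.

End Fractions.

(** Algebraic elements over a field are integral, and integrality is transitive. *)
Lemma algebraic_trans (D1 D2 : comNzRingType) (M : fieldType)
    (s : {rmorphism D1 -> M}) (t : {rmorphism D2 -> M}) a :
  (forall d, algebraic s (t d)) -> algebraic t a -> algebraic s a.
Proof.
have [K [i iP]] := ex_subfield (fractions_divring s).
move=> st [P P0 Pa]; apply/(algebraicE a iP)/integral_algebraic.
apply: (@integral_root _ _ i (map_poly t P)) => //; first by apply/eqP.
move=> _ /(nthP 0)[j _ <-]; rewrite coef_map.
by apply/integral_algebraic/(algebraicE _ iP); apply: st.
Qed.

Section Dependence.
Variables (k : comNzRingType) (M : fieldType) (i : {rmorphism k -> M}).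

Lemma mmap_in n (h : 'I_n -> M) (S : {pred M}) : GRing.divring_closed S ->
  (forall c, i c \in S) -> (forall j, h j \in S) -> forall p, mmap i h p \in S.
Proof.
move=> hS Sc Sh p.
have [K [u uP]] := ex_subfield hS.
have uS x : u x \in S by apply/uP; exists x.
apply: (big_ind (fun x => x \in S)).
- by rewrite -(rmorph0 u).
- by move=> _ _ /uP[x ->] /uP[y ->]; rewrite -rmorphD.
move=> m _; have /uP[x ->] := Sc (mcoeff m p).
have /uP[y ->] : mmap1 h m \in S; last by rewrite -rmorphM.
apply: (big_ind (fun x => x \in S)).
- by rewrite -(rmorph1 u).
- by move=> _ _ /uP[x' ->] /uP[y ->]; rewrite -rmorphM.
by move=> j _; have /uP[y ->] := Sh j; rewrite -rmorphXn.
Qed.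

Definition ev (s : seq M) : {rmorphism mpoly (size s) k -> M} :=
  mmap i (fun j : 'I_(size s) => s`_j).

Definition free (s : seq M) : Prop := forall p, ev s p = 0 -> p = 0.
Definition dep (s : seq M) (a : M) : Prop := algebraic (ev s) a.

Lemma ev_cons a s p : ev (a :: s) p = eval_poly (ev s) a (mcons p).
Proof. exact: mmap_mcons. Qed.

Lemma evX s (j : 'I_(size s)) : ev s (mvar j) = s`_j.
Proof. by rewrite /ev /= mmapX mmap1U. Qed.

Lemma evC s c : ev s (mpolyC _ c) = i c.
Proof. by rewrite /ev /= mmapC. Qed.

Lemma dep_const s c : dep s (i c).
Proof. by rewrite -(evC s); apply: algebraic_image. Qed.

Lemma dep_mem s a : a \in s -> dep s a.
Proof.
by case/(nthP 0) => j js <-; rewrite -(evX (Ordinal js)); apply: algebraic_image.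
Qed.

Lemma dep_ev s t p : (forall b, b \in t -> dep s b) -> dep s (ev t p).
Proof.
move=> st; apply/asboolP; apply: (mmap_in (S := fun a => `[< dep s a >])).
- exact: algebraic_divring.
- by move=> c; apply/asboolP/dep_const.
- by move=> j; apply/asboolP/st/mem_nth.
Qed.

Lemma dep_trans s t a : (forall b, b \in t -> dep s b) -> dep t a -> dep s a.
Proof. by move=> st; apply: algebraic_trans => p; apply: dep_ev. Qed.

Lemma dep_sub s t a : {subset t <= s} -> dep t a -> dep s a.
Proof. by move=> st; apply: dep_trans => b /st; apply: dep_mem. Qed.

Lemma freeP a s : free (a :: s) <-> free s /\ ~ dep s a.
Proof.
split=> [fas|[fs ds] p].
  split=> [p p0|[P P0 Pa]].
    have : muncons p%:P = 0 by apply: fas; rewrite ev_cons munconsK eval_polyC.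
    by move/(congr1 mcons); rewrite munconsK rmorph0 => /polyC_inj.
  have P0' : P = 0.
    by rewrite -(munconsK P) (fas (muncons P)) ?rmorph0 // ev_cons munconsK.
  by rewrite P0' rmorph0 eqxx in P0.
rewrite ev_cons => ep; apply: (can_inj (@mconsK _ _)); rewrite rmorph0.
have P0 : map_poly (ev s) (mcons p) = 0.
  by apply: contrapT => /eqP P0; apply: ds; exists (mcons p).
apply/polyP => j; rewrite coef0; apply: fs.
by rewrite -coef_map P0 coef0.
Qed.

Lemma free_swap a b s : free (a :: b :: s) -> free (b :: a :: s).
Proof.
pose o1 : 'I_(size s).+2 := lift ord0 ord0.
pose t : {rmorphism mpoly (size s).+2 k -> mpoly (size s).+2 k} :=
  mmap (@mpolyC _ k) (fun j => mvar (tperm ord0 o1 j)).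
have tX j : t (mvar j) = mvar (tperm ord0 o1 j) by rewrite /t /= mmapX mmap1U.
have tC c : t (mpolyC _ c) = mpolyC _ c by rewrite /t /= mmapC.
have tK : involutive t.
  apply: (mpoly_rmorph_ext (f := t \o t) (g := idfun)) => [c|j].
    by rewrite rmorph_compE !tC.
  by rewrite rmorph_compE !tX tpermK.
have evt p : ev (a :: b :: s) (t p) = ev (b :: a :: s) p.
  move: p; rewrite -/(_ =1 _).
  apply: (mpoly_rmorph_ext (f := ev (a :: b :: s) \o t)) => [c|j].
    by rewrite rmorph_compE tC !evC.
  rewrite rmorph_compE tX !evX; case: tpermP => [->|->|] //=.
  by case: j => [[|[|j]] jp] j0 j1 //=; [case: j0|case: j1]; apply: val_inj.
by move=> f p; rewrite -evt => /f e; rewrite -(tK p) e rmorph0.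
Qed.

Lemma free_move t a r : free (t ++ a :: r) -> free (a :: t ++ r).
Proof.
elim: t => // b t IH /freeP[/IH f nb]; apply: free_swap; apply/freeP.
split=> // h; apply: nb; apply: dep_sub h => c.
by rewrite !(inE, mem_cat) => /or3P[] ->; rewrite ?orbT.
Qed.

Lemma free_perm s t : perm_eq s t -> free s -> free t.
Proof.
elim: t s => [|a t IH] s st; first by rewrite (perm_small_eq _ st).
move=> fs; have as_ : a \in s by rewrite (perm_mem st) mem_head.
case/splitPr: as_ st fs => s1 s2 st fs.
have st' : perm_eq (s1 ++ s2) t.
  by rewrite -(perm_cons a); apply: perm_trans st; rewrite -cat1s perm_catCA.
have /freeP[f nd] := free_move fs; apply/freeP; split; first exact: IH st' f.
by move=> d; apply: nd; apply: dep_sub d => c; rewrite (perm_mem st').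
Qed.

(** The exchange property is the symmetry of algebraic independence in [a] and [b]. *)
Lemma exchange a b s : free s -> dep (b :: s) a -> ~ dep s a -> dep (a :: s) b.
Proof.
move=> fs d nd; apply: contrapT => nb.
have : free (b :: a :: s) by do 2![apply/freeP; split=> //].
by move/free_swap/freeP => -[].
Qed.

Hypothesis i0 : forall c, i c = 0 -> c = 0.

Lemma free_nil : free [::].
Proof.
by move=> p; rewrite (nvar0_mpolyC p) evC => /i0 ->; rewrite rmorph0.
Qed.

Lemma free_extend (s l : seq M) : free s -> exists t : seq M,
  [/\ {subset t <= l}, free (t ++ s) & forall a, a \in l -> dep (t ++ s) a].
Proof.
move=> fs; elim: l => [|a l [t [tl ft lt]]]; first by exists [::].
have [da|da] := pselect (dep (t ++ s) a).
  exists t; split=> // b; rewrite inE; first by move/tl->; rewrite orbT.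
  by case/predU1P => [->|/lt].
exists (a :: t); split.
- by move=> b; rewrite !inE => /predU1P[->|/tl->]; rewrite ?eqxx ?orbT.
- exact/freeP.
- move=> b /predU1P[->|/lt db]; first by apply: dep_mem; rewrite inE eqxx.
  by apply: dep_sub db => c cts; rewrite inE cts orbT.
Qed.

(** The exchange argument of Steinitz: elements of [s] are traded one at a time
    for elements of [t], which are put into [u]. *)
Lemma steinitz_ext s u t : free (t ++ u) ->
  (forall a, a \in t -> dep (s ++ u) a) -> (size t <= size s)%N.
Proof.
elim: s u t => [|b s IH] u t ft dt.
  by case: t ft dt => // a t /freeP[_ na] /(_ a (mem_head _ _)) da; case: na;
    apply: dep_sub da => c cu; rewrite mem_cat cu orbT.
have [all|nall] := pselect (forall a, a \in t -> dep (s ++ u) a).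
  exact: leqW (IH u t ft all).
have [a [at_ nda]] : exists a, a \in t /\ ~ dep (s ++ u) a.
  by apply: contrapT => h; apply: nall => a at_; apply: contrapT => nd; apply: h; exists a.
have [s0 [s0s fs0 s0d]] := free_extend (s ++ u) free_nil.
rewrite !cats0 in fs0 s0d.
have db : dep (a :: s ++ u) b.
  have : dep (a :: s0) b.
    apply: exchange => //.
      by apply: dep_trans (dt a at_) => c; rewrite inE => /predU1P[->|/s0d dc];
        [apply: dep_mem; rewrite inE eqxx|apply: dep_sub dc => e es; rewrite inE es orbT].
    by move=> da; apply: nda; apply: dep_sub da.
  by apply: dep_sub => c; rewrite !inE => /predU1P[->|/s0s->]; rewrite ?eqxx ?orbT.
case/splitPr: at_ ft dt => t1 t2 ft dt.
rewrite size_cat /= addnS -size_cat ltnS; apply: (IH (a :: u)).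
  by apply: free_perm ft; rewrite -!catA /= perm_cat2l -[a :: t2 ++ u]cat1s perm_catCA.
move=> c ct; have {}ct : c \in t1 ++ a :: t2.
  by move: ct; rewrite !(mem_cat, inE) => /orP[] ->; rewrite ?orbT.
apply: dep_trans (dt c ct) => e; rewrite inE => /predU1P[->|es].
  by apply: dep_sub db => x; rewrite !(mem_cat, inE) => /or3P[] ->; rewrite ?orbT.
by apply: dep_mem; move: es; rewrite !(mem_cat, inE) => /orP[] ->; rewrite ?orbT.
Qed.

Lemma steinitz s t : free t -> (forall a, a \in t -> dep s a) -> (size t <= size s)%N.
Proof.
by move=> ft dt; apply: (@steinitz_ext s [::] t); rewrite ?cats0.
Qed.

End Dependence.

Section TranscendenceDegree.
Variables (k F : fieldType) (i : {rmorphism k -> F}).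

Let i0 c : i c = 0 -> c = 0.
Proof. by move/eqP; rewrite fmorph_eq0 => /eqP. Qed.

Lemma alg_indepE n (x : n.-tuple F) : alg_indep i x <-> free i x.
Proof.
case: x => s sz; have e : size s = n by apply/eqP.
move: sz; subst n => sz; rewrite /alg_indep /free /ev /=.
suff -> : tnth (Tuple sz) = fun j => s`_j by [].
by apply/funext => j; rewrite (tnth_nth 0).
Qed.

Definition transcendence_basis (s : seq F) : Prop :=
  free i s /\ forall a, dep i s a.

Lemma has_trdegP n :
  has_trdeg i n <-> exists s, size s = n /\ transcendence_basis s.
Proof.
split=> [[x /alg_indepE fx mx]|[s [<- [fs ds]]]].
  exists x; rewrite size_tuple; split=> //; split=> // a.
  apply: contrapT => nd; apply: (mx a); apply/alg_indepE.
  exact/freeP.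
exists (in_tuple s); first exact/alg_indepE.
by move=> a /alg_indepE/freeP[_]; apply; apply: ds.
Qed.

Lemma basis_size s t : transcendence_basis s -> free i t -> (size t <= size s)%N.
Proof. by move=> [_ ds] ft; apply: (steinitz i0 ft). Qed.

Lemma trdeg_uniq m n : has_trdeg i m -> has_trdeg i n -> m = n.
Proof.
move=> /has_trdegP[s [<- bs]] /has_trdegP[t [<- bt]].
by apply/eqP; rewrite eqn_leq (basis_size bt (proj1 bs)) (basis_size bs (proj1 bt)).
Qed.

Lemma free_basis s t : transcendence_basis s -> free i t -> size t = size s ->
  transcendence_basis t.
Proof.
move=> bs ft st; split=> // a; apply: contrapT => nd.
have := @basis_size s (a :: t) bs; rewrite /= st ltnn => h.
by have /h : free i (a :: t) by apply/freeP.
Qed.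

Definition field_generators (l : seq F) : Prop := forall S : {pred F},
  GRing.divring_closed S -> (forall c, i c \in S) -> {subset l <= S} ->
  forall a, a \in S.

Lemma generators_dep l s : field_generators l ->
  (forall a, a \in l -> dep i s a) -> forall a, dep i s a.
Proof.
move=> gl ds a; apply/asboolP; apply: (gl (fun a => `[< dep i s a >])).
- exact: algebraic_divring.
- by move=> c; apply/asboolP/dep_const.
- by move=> b bl; apply/asboolP/ds.
Qed.

Lemma free_extend_basis l s : field_generators l -> free i s ->
  exists t : seq F, {subset t <= l} /\ transcendence_basis (t ++ s).
Proof.
move=> gl fs; have [t [tl ft dt]] := free_extend l fs.
by exists t; split=> //; split=> //; apply: generators_dep gl dt.
Qed.

End TranscendenceDegree.

(** * Specialization of algebraic elements *)

Lemma ex_min_size (T : Type) (sz : T -> nat) (P : T -> Prop) : (exists p, P p) ->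
  exists p, P p /\ forall q, P q -> (sz p <= sz q)%N.
Proof.
move=> exP; have exn : exists n, `[< exists p, P p /\ sz p = n >].
  by have [p Pp] := exP; exists (sz p); apply/asboolP; exists p.
case: (ex_minnP exn) => n /asboolP[p [Pp <-]] nmin; exists p; split=> // q Pq.
by apply: nmin; apply/asboolP; exists q.
Qed.

Lemma size_cancel_lead (D : comNzRingType) (p q : {poly D}) :
  q != 0 -> (size p <= size q)%N ->
  (size (lead_coef p *: q - lead_coef q *: (p * 'X^(size q - size p)))%R < size q)%N.
Proof.
move=> q0 pq; have sq : (0 < size q)%N by rewrite size_poly_gt0.
apply: (@leq_ltn_trans (size q).-1); last by rewrite prednK.
apply/leq_sizeP => j hj.
rewrite coefB !coefZ coefMXn; have [->|nj] := eqVneq j (size q).-1.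
  rewrite -lead_coefE; have [p0|p0] := eqVneq p 0.
    by rewrite p0 lead_coef0 coef0 !mul0r if_same mulr0 subrr.
  have sp : (0 < size p)%N by rewrite size_poly_gt0.
  have -> : ((size q).-1 < size q - size p)%N = false by lia.
  have -> : ((size q).-1 - (size q - size p) = (size p).-1)%N by lia.
  by rewrite -lead_coefE mulrC subrr.
have jq : (size q <= j)%N by rewrite -(prednK sq) ltn_neqAle eq_sym nj hj.
rewrite (nth_default 0 jq) mulr0; case: ifP => // h; first by rewrite mulr0 subrr.
rewrite nth_default ?mulr0 ?subrr // leq_subRL.
  by apply: leq_trans jq; rewrite subnK.
by apply: leq_trans (leq_subr _ _) jq.
Qed.

Section Relation.
Variables (D : comNzRingType) (M : fieldType) (s : {rmorphism D -> M}) (y : M).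

Lemma truncate (P : {poly D}) : exists p : {poly D},
  map_poly s p = map_poly s P /\ size (map_poly s p) = size p.
Proof.
pose n := size (map_poly s P); exists (take_poly n P).
have e : map_poly s (take_poly n P) = map_poly s P.
  apply/polyP => j; rewrite !coef_map coef_take_poly; case: ltnP => // nj.
  by rewrite -[in RHS]coef_map nth_default // ; apply: raddf0.
split=> //; apply/eqP; rewrite eqn_leq size_poly /= e.
exact: size_take_poly.
Qed.

Lemma eval_map (p q : {poly D}) :
  map_poly s p = map_poly s q -> eval_poly s y p = eval_poly s y q.
Proof. by rewrite !eval_polyE => ->. Qed.

Lemma lead_coef_trunc (p : {poly D}) : size (map_poly s p) = size p ->
  lead_coef (map_poly s p) = s (lead_coef p).
Proof. by rewrite !lead_coefE => ->; rewrite coef_map. Qed.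

(** This is the minimal polynomial of [y] over the fractions of the image of [D],
    with denominators cleared and no spurious leading terms in the kernel of [s]. *)
Definition minimal_relation (p : {poly D}) : Prop :=
  [/\ eval_poly s y p = 0, map_poly s p != 0, size (map_poly s p) = size p
    & forall q, eval_poly s y q = 0 -> (size (map_poly s q) < size p)%N ->
                map_poly s q = 0].

Lemma ex_minimal_relation : algebraic s y -> exists p, minimal_relation p.
Proof.
move=> [P0 P0n P0y].
have [P [[Pn Py] Pmin]] := @ex_min_size _ (fun P => size (map_poly s P))
  (fun P => map_poly s P != 0 /\ eval_poly s y P = 0)
  (ex_intro _ P0 (conj P0n P0y)).
have [p [ep sp]] := truncate P.
exists p; split; rewrite ?ep ?(eval_map ep) //; first by rewrite -ep.
move=> q qy sq; apply: contrapT => /eqP q0.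
by have := Pmin q (conj q0 qy); rewrite -ep sp leqNgt sq.
Qed.

Lemma minimal_relation_lead p : minimal_relation p -> s (lead_coef p) != 0.
Proof. by case=> _ p0 sp _; rewrite -lead_coef_trunc // lead_coef_eq0. Qed.

Lemma minimal_relation_size p : minimal_relation p -> (1 < size p)%N.
Proof.
case=> py p0 sp _; rewrite -sp ltnNge; apply/negP => /size1_polyC e.
move: py p0; rewrite eval_polyE e hornerC polyC_eq0 => ->.
by rewrite eqxx.
Qed.

(** A minimal relation is irreducible over the fractions of [D], so that a
    polynomial nonzero at [y] is invertible modulo it. Up to denominators, [b] is
    the last nonzero remainder of the Euclidean algorithm; it is reached as the
    polynomial of least degree that agrees at [y] with a multiple of [v]. *)
Lemma multiple_in_base p v : minimal_relation p -> eval_poly s y v != 0 ->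
  exists (b : D) (q : {poly D}), s b != 0 /\ eval_poly s y (q * v) = s b.
Proof.
move=> pm vy; have [py p0 sp pmin] := pm.
pose inV W := eval_poly s y W != 0 /\ exists q, eval_poly s y W = eval_poly s y (q * v).
have [W0 [W0V W0min]] := @ex_min_size _ (fun P => size (map_poly s P)) inV
  (ex_intro _ v (conj vy (ex_intro _ 1 (congr1 _ (esym (mul1r v)))))).
have [W [eW sW]] := truncate W0.
have [Wy [q Wq]] : inV W by rewrite /inV (eval_map eW).
have Wmin V : inV V -> (size W <= size (map_poly s V))%N.
  by move=> VV; rewrite -sW eW W0min.
have mW0 : map_poly s W != 0.
  by apply: contraNneq Wy => e; rewrite eval_polyE e horner0.
have W0n : W != 0 by apply: contraNneq mW0 => ->; rewrite rmorph0.
have lW : s (lead_coef W) != 0 by rewrite -lead_coef_trunc // lead_coef_eq0.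
have Wp : (size W < size p)%N.
  rewrite ltnNge; apply/negP => pW.
  pose V := lead_coef p *: W - lead_coef W *: (p * 'X^(size W - size p)).
  have eV : eval_poly s y V = s (lead_coef p) * eval_poly s y W.
    by rewrite /V -!mul_polyC rmorphB !rmorphM !eval_polyC py mul0r mulr0 subr0.
  have /Wmin : inV V.
    split; first by rewrite eV mulf_neq0 // minimal_relation_lead.
    by exists ((lead_coef p)%:P * q); rewrite eV Wq -mulrA [in RHS]rmorphM eval_polyC.
  apply/negP; rewrite -ltnNge; apply: leq_ltn_trans (size_poly _ _) _.
  exact: size_cancel_lead.
have [W1|W1] := leqP (size W) 1.
  have [b eb] : exists b, W = b%:P by exists W`_0; apply: size1_polyC.
  by exists b, q; rewrite -Wq eb eval_polyC; split=> //; move: Wy; rewrite eb eval_polyC.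
exfalso; have := Pdiv.ComRing.rdivp_eq W p.
set c := _ ^+ _; set Q := Pdiv.Ring.rdivp _ _; set r := Pdiv.Ring.rmodp _ _ => e.
have sr : (size r < size W)%N by apply: Pdiv.Ring.ltn_rmodpN0.
have c0 : s c != 0 by rewrite rmorphXn expf_neq0.
have eval_e : eval_poly s y Q * eval_poly s y W + eval_poly s y r = 0.
  by rewrite -rmorphM -rmorphD -e -mul_polyC rmorphM py mulr0.
have smr : (size (map_poly s r) < size W)%N by apply: leq_ltn_trans (size_poly _ _) sr.
have ry : eval_poly s y r = 0.
  apply: contrapT => /eqP ry.
  have /Wmin : inV r.
    split=> //; exists (- (Q * q)); rewrite mulNr rmorphN -mulrA rmorphM -Wq.
    by apply/eqP; rewrite -addr_eq0 addrC eval_e.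
  by rewrite leqNgt smr.
have mr0 : map_poly s r = 0 by apply: pmin => //; apply: ltn_trans smr Wp.
have Qy : eval_poly s y Q = 0.
  by move/eqP: eval_e; rewrite ry addr0 mulf_eq0 (negPf Wy) orbF => /eqP.
have me : s c *: map_poly s p = map_poly s Q * map_poly s W.
  by rewrite -rmorphM -[LHS]map_polyZ e rmorphD /= mr0 addr0.
have mQ0 : map_poly s Q != 0.
  by apply: contra_eq_neq me => ->; rewrite mul0r scaler_eq0 negb_or c0.
have /eqP := congr1 (size \o val) me; rewrite /= size_scale // size_mul // sp sW => ee.
have : map_poly s Q = 0.
  have aux a b : (0 < a -> 1 < b -> a < (a + b).-1)%N by lia.
  by apply: pmin => //; rewrite (eqP ee); apply: aux; rewrite // size_poly_gt0.
by apply/eqP.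
Qed.

End Relation.

(** That is, [f] factors through the image of [s]. *)
Definition compatible (D A B : nzRingType) (s : D -> A) (f : D -> B) : Prop :=
  forall d, s d = 0 -> f d = 0.

Section Compatible.
Variables (D Q : comNzRingType) (M : fieldType).
Variables (s : {rmorphism D -> M}) (f : {rmorphism D -> Q}).
Hypothesis sf : compatible s f.

Lemma map_compatible P : map_poly s P = 0 -> map_poly f P = 0.
Proof.
move=> sP; apply/polyP => j; rewrite coef_map coef0; apply: sf.
by rewrite -coef_map sP coef0.
Qed.

Lemma compatible_transcendental y z : ~ algebraic s y ->
  compatible (eval_poly s y) (eval_poly f z).
Proof.
move=> ny P Py; rewrite eval_polyE map_compatible ?horner0 //.
by apply: contrapT => /eqP P0; apply: ny; exists P.
Qed.

(** Pseudo-division by the minimal relation, whose leading coefficient stays regular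
    in [Q]. The target need not be a field: derivations will use dual numbers. *)
Lemma compatible_algebraic y z p : minimal_relation s y p ->
  eval_poly f z p = 0 -> (forall q, f (lead_coef p) * q = 0 -> q = 0) ->
  compatible (eval_poly s y) (eval_poly f z).
Proof.
move=> [py p0 sp pmin] pz lreg q.
have [n] := ubnP (size q); elim: n q => // n IHn q; rewrite ltnS => qn qy.
have [pq|qp] := leqP (size p) (size q); last first.
  rewrite eval_polyE map_compatible ?horner0 // pmin //.
  exact: leq_ltn_trans (size_poly _ _) qp.
have [->|q0] := eqVneq q 0; first by rewrite rmorph0.
pose r := lead_coef p *: q - lead_coef q *: (p * 'X^(size q - size p)).
apply: lreg; have : eval_poly f z r = 0.
  apply: IHn; first exact: leq_trans (size_cancel_lead q0 pq) qn.
  by rewrite /r -!mul_polyC rmorphB !rmorphM py qy mul0r !mulr0 subrr.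
by rewrite /r -!mul_polyC rmorphB !rmorphM pz mul0r mulr0 subr0 eval_polyC.
Qed.

End Compatible.

Definition infinite_field (K : fieldType) : Prop :=
  exists h : nat -> K, injective h.

Definition root_closed (K : fieldType) : Prop :=
  forall p : {poly K}, (1 < size p)%N -> exists x, root p x.

Lemma closedField_root_closed (k : closedFieldType) : root_closed k.
Proof. by move=> p p1; apply/closed_rootP; rewrite gtn_eqF. Qed.

Definition surjective (A B : Type) (f : A -> B) : Prop :=
  forall b, exists a, b = f a.

Lemma ex_nonroot (K : idomainType) (p : {poly K}) (h : nat -> K) :
  injective h -> p != 0 -> exists j, p.[h j] != 0.
Proof.
move=> hI p0; apply: contrapT => nx.
pose rs := [seq h j | j <- iota 0 (size p)].
have ar : all (root p) rs.
  apply/allP => _ /mapP[j _ ->]; apply: contrapT => /negP px; apply: nx.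
  by exists j.
have ur : uniq rs by rewrite map_inj_uniq ?iota_uniq.
by have := max_poly_roots p0 ar ur; rewrite size_map size_iota ltnn.
Qed.

Lemma infinite_extension (K L : fieldType) (i : {rmorphism K -> L}) :
  infinite_field K -> infinite_field L.
Proof. by move=> [h hI]; exists (i \o h) => a b /fmorph_inj/hI. Qed.

Lemma root_closed_extension (K L : fieldType) (i : {rmorphism K -> L}) :
  surjective i -> root_closed K -> root_closed L.
Proof.
move=> iS Kc p p1; have [q qp] := poly_lift (fun j => iS p`_j).
have [|x qx] := Kc q; first by rewrite -(size_map_poly i) qp.
by exists (i x); rewrite -qp mapf_root.
Qed.

(** A point of [D] in the open subset [u != 0] extends to [y]: if [y] is algebraic
    its value is a root of the minimal relation, and [u] contains the leading
    coefficient of this relation, which keeps its degree, and a multiple of [v]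
    lying in [D], which keeps [v] from vanishing; if [y] is transcendental any
    value that is not a root of [v] will do. The field grows only when the root
    does not exist. *)
Lemma specialization_step (D : comNzRingType) (M : fieldType)
    (s : {rmorphism D -> M}) (y : M) (v : {poly D}) : eval_poly s y v != 0 ->
  exists u, s u != 0 /\
    forall (K : fieldType) (f : {rmorphism D -> K}), infinite_field K ->
      compatible s f -> f u != 0 ->
      exists (L : fieldType) (i : {rmorphism K -> L}) (z : L),
        [/\ compatible (eval_poly s y) (eval_poly (i \o f) z),
            eval_poly (i \o f) z v != 0 & root_closed K -> surjective i].
Proof.
move=> vy; have [/ex_minimal_relation[p pm]|ny] := pselect (algebraic s y).
  have [b [q [b0 eb]]] := multiple_in_base pm vy.
  have lp := minimal_relation_lead pm.
  exists (lead_coef p * b); rewrite rmorphM mulf_neq0 //; split=> // K f Ki sf.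
  rewrite rmorphM mulf_eq0 negb_or => /andP[flp fb].
  have [L [i [z [pz iS]]]] : exists (L : fieldType) (i : {rmorphism K -> L}) (z : L),
      root (map_poly i (map_poly f p)) z /\ (root_closed K -> surjective i).
    have sfp : (1 < size (map_poly f p))%N.
      by rewrite size_poly_eq ?(minimal_relation_size pm) // -lead_coefE.
    have [[x px]|nx] := pselect (exists x, root (map_poly f p) x).
      exists K, idfun, x; split=> [|_ a]; last by exists a.
      by rewrite (_ : map_poly idfun _ = map_poly f p) // map_poly_id.
    have [L [i [z pz]]] := ex_root_extension sfp.
    by exists L, i, z; split=> // Kc; case: nx; apply: Kc.
  have sif : compatible s (i \o f) by move=> d /sf /= ->; rewrite rmorph0.
  have iflp : (i \o f) (lead_coef p) != 0 by rewrite /= fmorph_eq0.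
  exists L, i, z; have C : compatible (eval_poly s y) (eval_poly (i \o f) z).
    apply: (compatible_algebraic sif pm) => [|d /eqP].
      by rewrite eval_polyE map_poly_comp; apply/eqP.
    by rewrite mulf_eq0 (negPf iflp) => /eqP.
  split=> //; have : eval_poly (i \o f) z (q * v - b%:P) = 0.
    by apply: C; rewrite rmorphB eb eval_polyC subrr.
  rewrite rmorphB rmorphM eval_polyC => /eqP; rewrite subr_eq0 => /eqP e.
  have : (i \o f) b != 0 by rewrite /= fmorph_eq0.
  by rewrite -e mulf_eq0 negb_or => /andP[].
have v0 : map_poly s v != 0.
  by apply: contraNneq vy => v0; rewrite eval_polyE v0 horner0.
exists (v`_(size (map_poly s v)).-1).
rewrite -coef_map -lead_coefE lead_coef_eq0; split=> // K f Ki sf fu.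
have fv : map_poly f v != 0.
  by apply: contraNneq fu => e; rewrite -coef_map e coef0.
have [h hI] := Ki; have [j vz] := ex_nonroot hI fv.
exists K, idfun, (h j); split=> [||_ a]; last by exists a.
  by apply: compatible_transcendental.
by rewrite eval_polyE.
Qed.

(** Here [D'] is an iterated polynomial ring over [D] that presents the subring
    generated by [l]: a morphism defined on this subring is a morphism defined on
    [D'] and compatible with [s'], which avoids quotients and subring types. *)
Theorem specialization (M : fieldType) (l : seq M) (D : comNzRingType)
    (s : {rmorphism D -> M}) :
  exists (D' : comNzRingType) (c : {rmorphism D -> D'}) (s' : {rmorphism D' -> M}),
    [/\ forall d, s' (c d) = s d, forall a, a \in l -> exists d, a = s' d
      & forall v, s' v != 0 -> exists u, s u != 0 /\
        forall (K : fieldType) (f : {rmorphism D -> K}), infinite_field K ->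
          compatible s f -> f u != 0 ->
          exists (L : fieldType) (i : {rmorphism K -> L}) (f' : {rmorphism D' -> L}),
            [/\ compatible s' f', forall d, f' (c d) = i (f d), f' v != 0
              & root_closed K -> surjective i]].
Proof.
elim: l D s => [|y l IH] D s.
  exists D, idfun, s; split=> // v v0; exists v; split=> // K f Ki sf fv.
  by exists K, idfun, f; split=> // _ a; exists a.
have [D' [c [s' [s'c s'l H]]]] := IH _ (eval_poly s y).
exists D', (c \o polyC), s'; split.
- by move=> d; rewrite rmorph_compE s'c eval_polyC.
- move=> a /predU1P[->|/s'l] //.
  by exists (c 'X); rewrite s'c eval_polyX.
move=> v /H[u1 [/specialization_step[u [u0 Hu]] Hu1]]; exists u; split=> // K f Ki sf fu.
have [L [i [z [C iu1 iS]]]] := Hu K f Ki sf fu.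
have [L' [i' [f' [C' f'c f'v i'S]]]] :=
  Hu1 L (eval_poly (i \o f) z) (infinite_extension i Ki) C iu1.
exists L', (i' \o i), f'; split=> //.
- by move=> d; rewrite rmorph_compE f'c eval_polyC.
- move=> Kc a; have iS' := iS Kc.
  have [b ->] := i'S (root_closed_extension iS' Kc) a.
  by have [d ->] := iS' b; exists d.
Qed.

(** * Deformations of the identity and uniruledness *)

Lemma subset_map (A B : eqType) (g : A -> B) (l : seq A) (t : seq B) :
  {subset t <= map g l} -> exists T : seq A, {subset T <= l} /\ t = map g T.
Proof.
elim: t => [|b t IH] h; first by exists [::].
have /mapP[a al ->] : b \in map g l by apply: h; rewrite mem_head.
have [|T [Tl ->]] := IH; first by move=> x xt; apply: h; rewrite inE xt orbT.
by exists (a :: T); split=> // x /predU1P[->|/Tl].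
Qed.

Lemma rmorph_mmap (k A B : comNzRingType) (i : {rmorphism k -> A})
    (g : {rmorphism A -> B}) n (h : 'I_n -> A) p :
  g (mmap i h p) = mmap (g \o i) (g \o h) p.
Proof.
rewrite -rmorph_compE; move: p; apply: (mpoly_rmorph_ext (f := g \o mmap i h)) => [c|j].
  by rewrite rmorph_compE /= !mmapC.
by rewrite rmorph_compE /= !mmapX !mmap1U.
Qed.

Section Morphisms.
Variables (k A B : comNzRingType) (M : fieldType) (i : {rmorphism k -> A}).

Lemma free_mmap (j : {rmorphism k -> M}) n (s : seq M) (sn : size s = n) :
  free j s <-> forall p : mpoly n k, mmap j (fun l : 'I_n => s`_l) p = 0 -> p = 0.
Proof. by subst n. Qed.

Lemma dep_mmap (j : {rmorphism k -> M}) n (s : seq M) (sn : size s = n) a :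
  dep j s a <-> algebraic (mmap j (fun l : 'I_n => s`_l)) a.
Proof. by subst n. Qed.

(** A point of [A] at which algebraically independent elements [h] stay
    independent does not kill an element [w] algebraic over them: the constant
    term of a minimal relation for [w] is not killed. *)
Lemma independent_not_killed (g1 : {rmorphism A -> M}) (g2 : {rmorphism A -> B})
    n (h : 'I_n -> A) (w : A) : compatible g1 g2 ->
  algebraic (mmap (g1 \o i) (g1 \o h)) (g1 w) -> g1 w != 0 ->
  (forall p, mmap (g2 \o i) (g2 \o h) p = 0 -> p = 0) -> g2 w != 0.
Proof.
move=> g12 /ex_minimal_relation[p pm] w0 fr; have [py p0 sp pmin] := pm.
pose E := eval_poly (mmap i h) w p.
have Eg (C : comNzRingType) (g : {rmorphism A -> C}) :
    g E = eval_poly (mmap (g \o i) (g \o h)) (g w) p.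
  rewrite /E -rmorph_compE; move: p {E pm py p0 sp pmin}.
  apply: (poly_rmorph_ext (f := g \o eval_poly (mmap i h) w)) => [c|].
    by rewrite rmorph_compE !eval_polyC; apply: rmorph_mmap.
  by rewrite rmorph_compE !eval_polyX.
have /eqP : g2 E = 0 by apply: g12; rewrite Eg.
apply: contraTneq => gw; rewrite Eg gw eval_polyE horner_coef0 coef_map.
apply/eqP => /fr pc0.
have sp1 : (0 < size p)%N by apply: ltnW; apply: minimal_relation_size pm.
have ep : p = drop_poly 1 p * 'X.
  rewrite -[LHS](poly_take_drop 1) expr1.
  rewrite (_ : take_poly 1 p = 0) ?add0r //.
  by apply/polyP => -[|m]; rewrite coef_take_poly coef0 ?pc0.
have : map_poly (mmap (g1 \o i) (g1 \o h)) (drop_poly 1 p) = 0.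
  apply: pmin.
    apply/eqP; have := py; rewrite {1}ep rmorphM eval_polyX => /eqP.
    by rewrite mulf_eq0 (negPf w0) orbF.
  apply: leq_ltn_trans (size_poly _ _) _; rewrite size_drop_poly.
  by rewrite ltn_subrL.
by move=> e; case/eqP: p0; rewrite ep rmorphM /= e mul0r.
Qed.

End Morphisms.

Lemma algebraic_closed (k M : fieldType) (i : {rmorphism k -> M}) a :
  root_closed k -> algebraic i a -> exists c, a = i c.
Proof.
move=> kc [P]; rewrite map_poly_eq0.
have [n] := ubnP (size P); elim: n P => // n IH P; rewrite ltnS => Pn P0 Pa.
have [P1|P1] := leqP (size P) 1.
  have e := size1_polyC P1; move: Pa P0; rewrite e eval_polyC polyC_eq0 => /eqP.
  by rewrite fmorph_eq0 => ->.
have [c /factor_theorem[Q eQ]] := kc P P1.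
move: Pa; rewrite eQ rmorphM rmorphB eval_polyX eval_polyC => /eqP.
rewrite mulf_eq0 subr_eq0 => /orP[/eqP Qa|/eqP]; last by exists c.
have Q0 : Q != 0 by apply: contraNneq P0 => Q0; rewrite eQ Q0 mul0r.
apply: (IH Q) => //; apply: leq_trans Pn; rewrite eQ size_Mmonic ?monicXsubC //.
by rewrite size_XsubC addn2.
Qed.

Definition ring_generators (k Z : nzRingType) (i : k -> Z) (l : seq Z) : Prop :=
  forall S : {pred Z}, GRing.subring_closed S -> (forall c, i c \in S) ->
    {subset l <= S} -> forall z, z \in S.

Section Deformation.
Variables (k : fieldType) (Z : idomainType) (i : {rmorphism k -> Z}).
Hypotheses (kclosed : root_closed k) (kinf : infinite_field k).
Variables (l : seq Z) (lgen : ring_generators i l).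
Variable theta : {rmorphism Z -> {poly Z}}.
Hypothesis thetaC : forall c, theta (i c) = (i c)%:P.
Hypothesis theta0 : forall z, (theta z).[0] = z.
Variables (r0 : Z) (r0_moved : (1 < size (theta r0))%N).

Local Notation F := {fraction Z}.
Local Notation iF := (@tofrac Z \o i : {rmorphism k -> F}).

Lemma tofrac_inj0 (z : Z) : tofrac z = 0 -> z = 0.
Proof. by move/eqP; rewrite tofrac_eq0 => /eqP. Qed.

Lemma generators_image (A B : comNzRingType) (s : {rmorphism A -> B})
    (g : {rmorphism Z -> B}) : (forall c, exists d, g (i c) = s d) ->
  (forall z, z \in l -> exists d, g z = s d) -> forall z, exists d, g z = s d.
Proof.
move=> hc hl z; apply/asboolP; move: z.
apply: (lgen (S := fun z => `[< exists d, g z = s d >])).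
- split; first by apply/asboolP; exists 1; rewrite !rmorph1.
  + move=> x y /asboolP[a ea] /asboolP[b eb]; apply/asboolP; exists (a - b).
    by rewrite !rmorphB ea eb.
  + move=> x y /asboolP[a ea] /asboolP[b eb]; apply/asboolP; exists (a * b).
    by rewrite !rmorphM ea eb.
- by move=> c; apply/asboolP/hc.
- by move=> z /hl; apply: asboolT.
Qed.

Lemma fraction_generators : field_generators iF (map (@tofrac Z) l).
Proof.
move=> S hS hc hl x; have [K [u uP]] := ex_subfield hS.
have tS z : tofrac z \in S.
  apply/uP; move: z; apply: generators_image => [c|z zl]; apply/uP.
    exact: hc.
  by apply: hl; apply: map_f.
by have [a [b [b0 ->]]] := frac_div x; case: hS => _ _ Sd; apply: Sd.
Qed.

Lemma r0_transcendental : free iF [:: tofrac r0].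
Proof.
have iF0 c : iF c = 0 -> c = 0 by move/eqP; rewrite fmorph_eq0 => /eqP.
apply/freeP; split; first exact: free_nil iF0.
move=> d; have {d} : algebraic iF (tofrac r0).
  apply: algebraic_trans d => p; rewrite (nvar0_mpolyC p) evC.
  exact: algebraic_image.
case/(algebraic_closed kclosed) => c /eqP; rewrite tofrac_eq => /eqP e.
by move: r0_moved; rewrite e thetaC; rewrite ltnNge size_polyC_leq1.
Qed.

(** A general point of the divisor [r0 = c]. In a transcendence basis [r0 :: T] of
    [Frac Z] the value of [r0] is changed into [c] and the other ones are kept; this
    extends to [Z] for all but finitely many [c]. *)
Lemma deformation_point : exists (T : seq Z) (L : fieldType)
    (phi : {rmorphism Z -> L}) (c : k),
  [/\ transcendence_basis iF (map (@tofrac Z) (r0 :: T)), phi r0 = phi (i c),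
      free (phi \o i) (map phi T) & phi (lead_coef (theta r0)) != 0].
Proof.
have [t [tl tb]] := free_extend_basis fraction_generators r0_transcendental.
have [T [_ eT]] := subset_map tl.
pose tF := map (@tofrac Z) T.
have fr : free iF (tofrac r0 :: tF).
  by apply: free_perm (proj1 tb); rewrite perm_catC eT.
have b1 : transcendence_basis iF (tofrac r0 :: tF).
  by apply: free_basis tb fr _; rewrite eT size_cat addnC.
pose s := ev iF (tofrac r0 :: tF).
have [D' [c [s' [s'c s'l H]]]] := specialization (map (@tofrac Z) l) s.
have Zs' z : exists d, tofrac z = s' d.
  move: z; apply: (generators_image (g := @tofrac Z)) => [a|z zl].
    by exists (c (mpolyC _ a)); rewrite s'c /s evC.
  exact/s'l/map_f.
have [v evv] := Zs' (lead_coef (theta r0)).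
have v0 : s' v != 0.
  rewrite -evv tofrac_eq0 lead_coef_eq0 -size_poly_gt0.
  exact: ltnW r0_moved.
have [u [u0 Hu]] := H v v0.
have mu0 : map_poly (ev iF tF) (mcons u) != 0.
  apply: contra_neq u0 => e; rewrite /s ev_cons eval_polyE e horner0.
  by [].
have [h hI] := kinf.
have hFI : injective (iF \o h) by move=> a b /fmorph_inj/hI.
have [j uj] := ex_nonroot hFI mu0.
(* [u] does not vanish identically on the divisor [r0 = lam] *)
pose lam := h j; pose f := ev iF (iF lam :: tF).
have sf : compatible s f by move=> p /fr ->; rewrite rmorph0.
have fu : f u != 0 by rewrite /f ev_cons eval_polyE.
have [L [io [f' [C f'c f'v _]]]] := Hu F f (infinite_extension iF kinf) sf fu.
have [phi phiP] : exists phi : {rmorphism Z -> L},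
    forall z, exists d, tofrac z = s' d /\ phi z = f' d.
  apply: (rmorph_of_graph (G := fun z w => exists d, tofrac z = s' d /\ w = f' d)).
  - by move=> z; have [d e] := Zs' z; exists (f' d), d.
  - by move=> _ [d [/esym e ->]]; apply: C; rewrite e rmorph0.
  - by exists 1; rewrite !rmorph1.
  - move=> a _ b _ [d [ed ->]] [d' [ed' ->]]; exists (d - d').
    by rewrite tofracB !rmorphB ed ed'.
  - move=> a _ b _ [d [ed ->]] [d' [ed' ->]]; exists (d * d').
    by rewrite tofracM !rmorphM ed ed'.
have phi_s z d : tofrac z = s' d -> phi z = f' d.
  move=> e; have [d' [e' ->]] := phiP z.
  apply/eqP; rewrite -subr_eq0 -rmorphB; apply/eqP/C.
  by rewrite rmorphB -e -e' subrr.
have phiC a : phi (i a) = io (iF a).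
  by rewrite (phi_s _ (c (mpolyC _ a))) ?f'c /f ?evC // s'c /s evC.
exists T, L, phi, lam; split=> //.
- rewrite phiC (phi_s _ (c (mvar ord0))).
    by rewrite f'c /f (evX _ (s := iF lam :: tF) ord0).
  by rewrite s'c /s (evX _ (s := tofrac r0 :: tF) ord0).
- apply/(free_mmap _ (size_map _ T)) => p.
  have -> : mmap (phi \o i) (fun j : 'I_(size T) => (map phi T)`_j) p =
            io (mmap iF (fun j : 'I_(size T) => tF`_j) p).
    rewrite rmorph_mmap; congr (mmap _ _ p).
      by apply/funext => a; apply: phiC.
    apply/funext => a /=; rewrite !(nth_map 0) //.
    have aT : (a < size tF)%N by rewrite size_map.
    rewrite (phi_s _ (c (mvar (lift ord0 (Ordinal aT))))).
      by rewrite f'c /f (evX _ (s := iF lam :: tF)) /= (nth_map 0) ?add0n.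
    by rewrite s'c /s (evX _ (s := tofrac r0 :: tF)) /= (nth_map 0) ?add0n.
  move/eqP; rewrite fmorph_eq0 => /eqP; move: p.
  by apply/free_mmap; [rewrite size_map|case/freeP: fr].
- by rewrite (phi_s _ v).
Qed.

(** On the divisor [r0 = c] the values of [T] are still independent and remain so
    along the deformation, as is seen at [X = 0]. Adding [theta r0] keeps
    independence: at [X = 0] a relation, as a polynomial in its first variable,
    is seen to vanish at [c], and the factor [theta r0 - c] can be cancelled
    because [theta r0] is not constant. *)
Lemma deformation_independent (E : fieldType) (phi : {rmorphism Z -> E}) (T : seq Z)
    (c : k) : phi r0 = phi (i c) -> free (phi \o i) (map phi T) ->
  phi (lead_coef (theta r0)) != 0 ->
  forall p : mpoly (size T).+1 k,
    mmap ((map_poly phi \o theta) \o i)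
         ((map_poly phi \o theta) \o (fun j : 'I_(size T).+1 => (r0 :: T)`_j)) p = 0 ->
    p = 0.
Proof.
move=> phir fT lead0 p.
pose th : {rmorphism Z -> {poly E}} := map_poly phi \o theta.
have th0 z : (th z).[0] = phi z.
  by rewrite /th /= -{1}(rmorph0 phi) horner_map theta0.
have thC a : th (i a) = (phi (i a))%:P by rewrite /th /= thetaC map_polyC.
have thr : th r0 - (phi r0)%:P != 0.
  rewrite subr_eq0; apply: contraTneq r0_moved => e.
  have : size (th r0) = size (theta r0) by rewrite /th /= size_poly_eq -?lead_coefE.
  by rewrite e => <-; rewrite -leqNgt size_polyC_leq1.
pose sT := mmap (th \o i) (th \o (fun j : 'I_(size T) => T`_j)) :
  {rmorphism mpoly (size T) k -> {poly E}}.
pose sE := mmap (phi \o i) (fun j : 'I_(size T) => (map phi T)`_j) :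
  {rmorphism mpoly (size T) k -> E}.
have sT0 q : (sT q).[0] = sE q.
  pose e0 := eval_poly (idfun : {rmorphism E -> E}) 0.
  have e0E q' : e0 q' = q'.[0] by rewrite eval_polyE map_poly_id.
  rewrite -e0E /sT /sE /= rmorph_mmap; congr (mmap _ _ q).
    by apply/funext => a; rewrite /comp e0E th0.
  by apply/funext => a; rewrite /comp e0E th0 (nth_map 0).
have sE0 q : sE q = 0 -> q = 0 by move: q; apply/(free_mmap _ (size_map _ T)).
suff key (P : {poly mpoly (size T) k}) : eval_poly sT (th r0) P = 0 -> P = 0.
  move=> e; apply: (can_inj (@mconsK _ _)); rewrite rmorph0; apply: key.
  by rewrite -[RHS]e [RHS]mmap_mcons.
have [m] := ubnP (size P); elim: m P => // m IH P; rewrite ltnS => Pm ePth.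
have [//|P0] := eqVneq P 0.
have /factor_theorem[Q eQ] : root P (mpolyC _ c).
  apply/eqP/sE0; have := congr1 (fun q => q.[0]) ePth; rewrite horner0 => <-.
  rewrite -sT0; have -> : P.[mpolyC _ c] = eval_poly idfun (mpolyC _ c) P.
    by rewrite eval_polyE map_poly_id.
  pose e0 := eval_poly (idfun : {rmorphism E -> E}) 0.
  have e0E q' : e0 q' = q'.[0] by rewrite eval_polyE map_poly_id.
  rewrite -!e0E; move: (P); apply: (poly_rmorph_ext
    (f := e0 \o sT \o eval_poly idfun (mpolyC _ c)) (g := e0 \o eval_poly sT (th r0))) => [a|].
    by rewrite !rmorph_compE !eval_polyC.
  rewrite !rmorph_compE !eval_polyX !e0E th0 phir.
  have -> : sT (mpolyC _ c) = th (i c) by rewrite /sT /= mmapC.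
  by rewrite th0.
have : eval_poly sT (th r0) Q = 0.
  move: ePth; rewrite eQ rmorphM rmorphB eval_polyX eval_polyC.
  have -> : sT (mpolyC _ c) = (phi r0)%:P by rewrite /sT /= mmapC [LHS]thC phir.
  by move/eqP; rewrite mulf_eq0 (negPf thr) orbF => /eqP.
move=> eQth; have Q0 : Q != 0 by apply: contraNneq P0 => Q0; rewrite eQ Q0 mul0r.
have : (size Q < m)%N.
  by apply: leq_trans Pm; rewrite eQ size_Mmonic ?monicXsubC // size_XsubC addn2.
by move/(IH Q)/(_ eQth)/eqP; rewrite (negPf Q0).
Qed.

(** [E] is the function field of a component of [r0 = c]. A further independent
    element of [E] would lift to a transcendence basis of [Frac Z], and then
    [r0 - c], being algebraic over this basis, could not be killed. *)
Theorem deformation_uniruled : uniruled iF.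
Proof.
have [T [L [phiL [c [bT phir fT lead0]]]]] := deformation_point.
have [E [e eP]] := ex_subfield (fractions_divring phiL).
have [phi phiE] : exists phi : {rmorphism Z -> E}, forall z, phiL z = e (phi z).
  apply: (rmorph_of_graph (G := fun z x => phiL z = e x)).
    - by move=> z; apply/eP/fractions_image.
    - by move=> x /esym/eqP; rewrite rmorph0 fmorph_eq0 => /eqP.
    - by rewrite !rmorph1.
    - by move=> a x b y ea eb; rewrite !rmorphB ea eb.
    - by move=> a x b y ea eb; rewrite !rmorphM ea eb.
have phir' : phi r0 = phi (i c) by apply: (fmorph_inj e); rewrite -!phiE.
have lead0' : phi (lead_coef (theta r0)) != 0 by rewrite -(fmorph_eq0 e) -phiE.
pose j : {rmorphism k -> E} := phi \o i.
have fT' : free j (map phi T).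
  apply/(free_mmap _ (size_map _ T)) => p p0.
  apply: (proj1 (free_mmap _ (size_map _ T)) fT).
  rewrite -[RHS](rmorph0 e) -p0 rmorph_mmap; congr (mmap _ _ p).
    by apply/funext => a; apply: phiE.
  by apply/funext => a; rewrite /comp !(nth_map 0) // phiE.
have indep := deformation_independent phir' fT' lead0'.
have Zgen (S : {pred E}) : GRing.divring_closed S -> (forall a, j a \in S) ->
    {subset map phi l <= S} -> forall x, x \in S.
  move=> hS hc hl x; have [K [u uP]] := ex_subfield hS.
  have pS z : phi z \in S.
    apply/uP; move: z; apply: generators_image => [a|z zl]; apply/uP; first exact: hc.
    by apply: hl; apply: map_f.
  have /fractionsP[a [b [b0 ex]]] : e x \in fractions phiL by apply/eP; exists x.
  have -> : x = phi a / phi b.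
    by apply: (fmorph_inj e); rewrite fmorph_div -!phiE.
  by case: hS => _ _ Sd; apply: Sd.
have trF : has_trdeg iF (size T).+1.
  by apply/has_trdegP; eexists; split; last exact: bT; rewrite /= size_map.
have r0c : tofrac (r0 - i c) != 0 :> F.
  rewrite tofrac_eq0 subr_eq0; apply: contraTneq r0_moved => ->.
  by rewrite thetaC -leqNgt size_polyC_leq1.
have tofrac_compat (C : nzRingType) (g : {rmorphism Z -> C}) : compatible (@tofrac Z) g.
  by move=> z /tofrac_inj0 ->; rewrite rmorph0.
have trE : has_trdeg j (size T).
  apply/has_trdegP; exists (map phi T); rewrite size_map; split=> //; split=> //.
  apply: generators_dep Zgen _ => _ /mapP[z zl ->].
  apply: contrapT => nd.
  have fz : free j (map phi (z :: T)) by apply/freeP.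
  have fzF : free iF (map (@tofrac Z) (z :: T)).
    apply/(free_mmap _ (size_map _ (z :: T))) => p p0.
    apply: (proj1 (free_mmap _ (size_map _ (z :: T))) fz).
    have e1 (C : comNzRingType) (g : {rmorphism Z -> C}) :
        mmap (g \o i) (fun a : 'I_(size (z :: T)) => (map g (z :: T))`_a) p =
        g (mmap i (fun a : 'I_(size (z :: T)) => (z :: T)`_a) p).
      rewrite rmorph_mmap; congr (mmap _ _ p).
      by apply/funext => a; rewrite /comp (nth_map 0).
    rewrite [LHS]e1 (_ : mmap i _ p = 0) ?rmorph0 //.
    by apply: tofrac_inj0; rewrite -[RHS]p0 [RHS]e1.
  have bz := free_basis bT fzF (etrans (size_map _ _) (esym (size_map _ (r0 :: T)))).
  have : phi (r0 - i c) != 0.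
    apply: (@independent_not_killed k Z E _ i (@tofrac Z) phi _
      (fun a : 'I_(size (z :: T)) => (z :: T)`_a)) => //.
      have := proj2 bz (tofrac (r0 - i c)); move/(dep_mmap _ (size_map _ (z :: T))).
      congr (algebraic (mmap _ _) _); apply/funext => a.
      by rewrite /comp (nth_map 0).
    move=> p p0; apply: (proj1 (free_mmap _ (size_map _ (z :: T))) fz).
    rewrite -[RHS]p0; congr (mmap _ _ p); apply/funext => a.
    by rewrite /comp (nth_map 0).
  by rewrite rmorphB phir' subrr eqxx.
pose th : {rmorphism Z -> {poly E}} := map_poly phi \o theta.
have th_inj z : th z = 0 -> z = 0.
  move=> thz; apply: contrapT => /eqP z0.
  have : th z != 0; last by rewrite thz eqxx.
  apply: (@independent_not_killed k Z {poly E} _ i (@tofrac Z) th _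
      (fun a : 'I_(size (r0 :: T)) => (r0 :: T)`_a)) => //; last by rewrite tofrac_eq0.
  have := proj2 bT (tofrac z); move/(dep_mmap _ (size_map _ (r0 :: T))).
  congr (algebraic (mmap _ _) _); apply/funext => a.
  by rewrite /comp (nth_map 0).
pose thF : {rmorphism Z -> rational_functions E} := @tofrac {poly E} \o th.
have [|g gP] := @frac_rmorph _ _ thF.
  by move=> z /eqP; rewrite tofrac_eq0 => /eqP/th_inj.
exists E, j, (size T); split=> //.
  by exists (map phi l) => S hS hc hl; apply: Zgen.
exists g; first exact: fmorph_inj.
move=> a; rewrite gP /thF /= thetaC map_polyC.
by [].
Qed.

End Deformation.

(** * Isomorphic polynomial rings *)

Section CommutativeCancellation.
Variables (k : fieldType) (Z : idomainType) (S : comNzRingType) (d : nat).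
Variables (i : {rmorphism k -> Z}) (j : {rmorphism k -> S}).
Variables (g : {rmorphism mpoly d Z -> mpoly d S}).
Variables (g' : {rmorphism mpoly d S -> mpoly d Z}).
Hypotheses (gK : cancel g g') (g'K : cancel g' g).
Hypothesis gC : forall c, g (mpolyC d (i c)) = mpolyC d (j c).

(** The subfield [k] is infinite, so that its points are dense in affine space over
    [Z]. *)
Lemma mpoly_nonroot n (p : mpoly n Z) : infinite_field k -> p != 0 ->
  exists h : 'I_n -> k, mmap idfun (i \o h) p != 0.
Proof.
move=> [a aI]; elim: n p => [|n IH] p p0.
  exists (fun=> 0); move: p0; rewrite (nvar0_mpolyC p) mmapC /=.
  by apply: contra_neq => ->; rewrite rmorph0.
have mp0 : mcons p != 0.
  by apply: contra_neq p0 => e; apply: (can_inj (@mconsK _ _)); rewrite e rmorph0.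
have [h hp] := IH _ (etrans (congr1 negb (lead_coef_eq0 (mcons p))) mp0).
pose e : {rmorphism mpoly n Z -> Z} := mmap idfun (i \o h).
have q0 : map_poly e (mcons p) != 0.
  apply: contra_neq hp => q0; rewrite lead_coefE.
  by rewrite -[LHS](coef_map e) q0 coef0.
have iaI : injective (i \o a) by move=> x y /fmorph_inj/aI.
have [m hm] := ex_nonroot iaI q0.
exists (fun l => if unlift ord0 l is Some l' then h l' else a m).
apply: contra_neq hm => e0; rewrite -[RHS]e0 [RHS]mmap_mcons /= unlift_none eval_polyE.
congr (map_poly _ _).[_]; congr (mmap _ _).
by apply/funext => l; rewrite /= liftK.
Qed.

Definition constant_mpoly (R : nzRingType) (p : mpoly d R) : Prop :=
  exists c, p = mpolyC d c.

Lemma nonconstantP (R : nzRingType) (p : mpoly d R) :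
  ~ constant_mpoly p -> exists m, m != (@mnm0 d) /\ mcoeff m p != 0.
Proof.
move=> np; apply: contrapT => h; apply: np; exists (mcoeff (@mnm0 d) p).
apply/mpolyP => m; rewrite mcoeffC; have [->|m0] := eqVneq m (@mnm0 d).
  by rewrite mulr1.
rewrite mulr0; apply/eqP; apply: contrapT => /negP pm; apply: h.
by exists m; rewrite m0 pm.
Qed.

Section Deform.
Hypothesis (kinf : infinite_field k).
Variables (phi : {rmorphism mpoly d S -> Z}).
Hypothesis phi_g : forall z, phi (g (mpolyC d z)) = z.
Local Notation phiC := (phi \o @mpolyC d S : {rmorphism S -> Z}).

(** The line through the point [phi] of the affine space over [S] in the direction
    [mu], read in the coordinates of [Z]. *)
Definition deform (mu : 'I_d -> k) : {rmorphism Z -> {poly Z}} :=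
  (mmap (polyC \o phiC) (fun l => (phi (mvar l))%:P + (i (mu l))%:P * 'X)
    : {rmorphism mpoly d S -> {poly Z}}) \o g \o @mpolyC d Z.

Lemma deform_const mu c : deform mu (i c) = (i c)%:P.
Proof.
by rewrite /deform !rmorph_compE gC mmap_constE /= -gC phi_g.
Qed.

Lemma horner_deform mu z x : (deform mu z).[x] =
  mmap phiC (fun l => phi (mvar l) + i (mu l) * x) (g (mpolyC d z)).
Proof.
pose e := eval_poly (idfun : {rmorphism Z -> Z}) x.
have eE q : e q = q.[x] by rewrite eval_polyE map_poly_id.
rewrite -eE /deform !rmorph_compE /= rmorph_mmap; congr (mmap _ _ _).
  by apply/funext => a; rewrite /= eE hornerC.
by apply/funext => a; rewrite /= eE !hornerE.
Qed.

Lemma deform0 mu z : (deform mu z).[0] = z.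
Proof.
rewrite horner_deform -[RHS]phi_g.
move: (g _) => q; move: q; apply: (mpoly_rmorph_ext (f := mmap phiC _)) => [c|l] /=.
  by rewrite mmapC.
by rewrite mmapX mmap1U mulr0 addr0.
Qed.

(** If [deform mu r0] were constant for all [mu], then [g r0], with its coefficients
    evaluated by [phi], would take one value at all the translates by [k]-points of
    the point with coordinates [phi (mvar l)], hence be constant. *)
Lemma ex_deform (r0 : Z) m : m != (@mnm0 d) -> phiC (mcoeff m (g (mpolyC d r0))) != 0 ->
  exists mu, (1 < size (deform mu r0))%N.
Proof.
move=> m0 qm; pose q := g (mpolyC d r0).
pose P := mmap (@mpolyC d Z \o phiC) (fun l => mpolyC d (phi (mvar l)) + mvar l) q
          - mpolyC d r0.
have P0 : P != 0.
  apply: contraNneq qm => P0.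
  pose t : {rmorphism mpoly d Z -> mpoly d Z} :=
    mmap (@mpolyC d Z) (fun l => mvar l - mpolyC d (phi (mvar l))).
  have : map_mpoly phiC q = mpolyC d r0.
    have <- : t (mpolyC d r0) = mpolyC d r0 by rewrite /t /= mmapC.
    move/eqP: P0; rewrite subr_eq0 => /eqP <-.
    move: (q) => q1; rewrite -[RHS]rmorph_compE; move: q1.
    apply: (mpoly_rmorph_ext (f := map_mpoly phiC)) => [c|l].
      by rewrite rmorph_compE !mmap_constE.
    rewrite rmorph_compE !mmap_varE rmorphD mmap_constE mmap_varE.
    by rewrite addrC subrK.
  move/(congr1 (mcoeff m)); rewrite mcoeff_map_mpoly mcoeffC => ->.
  by rewrite (negPf m0) mulr0.
have [mu Pmu] := mpoly_nonroot kinf P0.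
exists mu; rewrite ltnNge; apply/negP => /size1_polyC e.
have : (deform mu r0).[1] = (deform mu r0).[0] by rewrite e !hornerC.
rewrite deform0 horner_deform => e1; case/eqP: Pmu.
rewrite /P rmorphB /= mmapC /= rmorph_mmap -[X in _ - X]e1; apply/eqP.
rewrite subr_eq0; apply/eqP; congr (mmap _ _ q).
  by apply/funext => a; rewrite /= mmapC.
by apply/funext => a; rewrite /= rmorphD /= mmapC mmapX mmap1U /= mulr1.
Qed.

End Deform.

(** The section [t = lam] is chosen so that a coefficient of [g r0] at a nontrivial
    monomial survives in [phi]; the direction [mu] of the line then exists. *)
Lemma nonconstant_uniruled (l : seq Z) : root_closed k -> infinite_field k ->
  ring_generators i l -> ~ (forall z, constant_mpoly (g (mpolyC d z))) ->
  uniruled (@tofrac Z \o i : {rmorphism k -> {fraction Z}}).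
Proof.
move=> kc kinf lgen nconst.
have [r0 r0n] : exists r0, ~ constant_mpoly (g (mpolyC d r0)).
  by apply: contrapT => h; apply: nconst => z; apply: contrapT => hz; apply: h; exists z.
have [m [m0 qm]] := nonconstantP r0n.
set b := mcoeff m _ in qm.
have w0 : g' (mpolyC d b) != 0.
  apply: contra_neq qm => e; apply/eqP; rewrite -(mpolyC_eq0 d) -(g'K (mpolyC d b)) e.
  by rewrite rmorph0.
have [lam lamw] := mpoly_nonroot kinf w0.
pose phi : {rmorphism mpoly d S -> Z} :=
  (mmap idfun (i \o lam) : {rmorphism mpoly d Z -> Z}) \o g'.
have phi_g z : phi (g (mpolyC d z)) = z by rewrite /phi rmorph_compE gK mmap_constE.
have [mu hmu] := ex_deform kinf phi_g m0 lamw.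
apply: (deformation_uniruled kc kinf lgen (theta := deform phi mu)) hmu.
  exact: deform_const.
exact: deform0.
Qed.

(** The element [u0] in the kernel of the retraction [pi] is algebraic over the
    [s_j] with coefficients in [Z], because [tX] generates and has as many elements
    as [tS]. The morphism [g2], which applies [g0 \o pi] to the coefficients in [S],
    keeps the [s_j] independent but kills [u0]. *)
Lemma constants_onto : (forall z, constant_mpoly (g (mpolyC d z))) ->
  forall u, constant_mpoly (g' (mpolyC d u)).
Proof.
move=> gconst u.
have [g0 g0E] : exists g0 : {rmorphism Z -> S}, forall z, g (mpolyC d z) = mpolyC d (g0 z).
  apply: (rmorph_of_graph (G := fun z x => g (mpolyC d z) = mpolyC d x)) => //.
  - by move=> x; rewrite !rmorph0 => /esym/eqP; rewrite mpolyC_eq0 => /eqP.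
  - by rewrite !rmorph1.
  - by move=> a x b y ea eb; rewrite !rmorphB ea eb.
  - by move=> a x b y ea eb; rewrite !rmorphM ea eb.
pose pi : {rmorphism S -> Z} :=
  (mmap idfun (fun=> 0) : {rmorphism mpoly d Z -> Z}) \o g' \o @mpolyC d S.
have pi_g0 z : pi (g0 z) = z.
  have -> : pi (g0 z) = mmap idfun (fun=> 0) (g' (mpolyC d (g0 z))) by [].
  by rewrite -g0E gK mmapC.
pose u0 := u - g0 (pi u).
have piu0 : pi u0 = 0 by rewrite /u0 rmorphB pi_g0 subrr.
suff u00 : u0 = 0.
  exists (pi u); apply: (can_inj gK); rewrite g'K g0E; congr mpolyC.
  by apply/eqP; rewrite -subr_eq0 -/u0 u00.
apply: contrapT => /eqP u0n.
pose w := g' (mpolyC d u0).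
have w0 : w != 0.
  apply: contra_neq u0n => e; apply/eqP; rewrite -(mpolyC_eq0 d) -(g'K (mpolyC d u0)).
  by rewrite -/w e rmorph0.
pose t := @tofrac (mpoly d Z); pose iQ : {rmorphism Z -> {fraction (mpoly d Z)}} :=
  t \o @mpolyC d Z.
have iQ0 c : iQ c = 0 -> c = 0.
  by move/eqP; rewrite /iQ /= tofrac_eq0 mpolyC_eq0 => /eqP.
pose tX := [seq t (mvar a) | a <- enum 'I_d].
pose tS := [seq t (g' (mvar a)) | a <- enum 'I_d].
have stX : size tX = d by rewrite size_map size_enum_ord.
have stS : size tS = d by rewrite size_map size_enum_ord.
have nthX (h : 'I_d -> {fraction (mpoly d Z)}) (a : 'I_d) : [seq h b | b <- enum 'I_d]`_a = h a.
  by rewrite (nth_map a) ?size_enum_ord // nth_ord_enum.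
have t_mmap (h : 'I_d -> mpoly d Z) p : t (mmap (@mpolyC d Z) h p) = mmap iQ (t \o h) p.
  exact: rmorph_mmap.
have id_mmap (p : mpoly d Z) : p = mmap (@mpolyC d Z) (fun a => mvar a) p.
  move: p; apply: (mpoly_rmorph_ext (f := idfun)) => [c|a].
    by rewrite mmap_constE.
  by rewrite mmap_varE.
have dX a : dep iQ tX a.
  have [p [q [q0 ->]]] := frac_div a.
  have tp (x : mpoly d Z) : t x \in (fun a => `[< dep iQ tX a >]).
    rewrite (id_mmap x) t_mmap; apply: mmap_in; first exact: algebraic_divring.
      by move=> c; apply/asboolP/dep_const.
    move=> a'; apply/asboolP/dep_mem; rewrite /comp.
    by apply: map_f; rewrite mem_enum.
  by apply/asboolP; case: (algebraic_divring (ev iQ tX)) => _ _ D; apply: D; apply: tp.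
have map_g0 p : g (mmap (@mpolyC d Z) (fun a => g' (mvar a)) p) = map_mpoly g0 p.
  rewrite rmorph_mmap; congr (mmap _ _ p); apply/funext => a.
    by rewrite /= g0E.
  by rewrite /= g'K.
have g00 p : map_mpoly g0 p = 0 -> p = 0.
  move=> e; apply/mpolyP => m; rewrite mcoeff0 -[LHS]pi_g0 -mcoeff_map_mpoly e.
  by rewrite mcoeff0 rmorph0.
have fS : free iQ tS.
  apply/(free_mmap _ stS) => p; rewrite (_ : (fun _ => _) = t \o (fun a => g' (mvar a))); last first.
    by apply/funext => a; rewrite /tS nthX.
  rewrite -t_mmap => /eqP; rewrite tofrac_eq0 => /eqP e; apply: g00.
  by rewrite -map_g0 e rmorph0.
have dw : dep iQ tS (t w).
  apply: contrapT => nd; have fw : free iQ (t w :: tS) by apply/freeP.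
  have := steinitz iQ0 fw (fun a _ => dX a).
  by rewrite /= stX stS ltnn.
pose g2 : {rmorphism mpoly d Z -> mpoly d S} := map_mpoly (g0 \o pi) \o g.
have : g2 w != 0.
  apply: (@independent_not_killed Z (mpoly d Z) (mpoly d S) _ (@mpolyC d Z) t g2 _
    (fun a => g' (mvar a))).
  - by move=> z /eqP; rewrite tofrac_eq0 => /eqP->; rewrite rmorph0.
  - have dS : (fun a : 'I_d => tS`_a) = t \o (fun a => g' (mvar a)).
      by apply/funext => a; rewrite /tS nthX.
    by move: dw => /(dep_mmap _ stS); rewrite dS.
  - by rewrite tofrac_eq0.
  move=> p e; apply: g00; rewrite -[RHS]e; congr (mmap _ _ p); apply/funext => a.
    by rewrite /comp /g2 rmorph_compE g0E [RHS]map_mpolyC; congr mpolyC; apply: (congr1 g0 (esym (pi_g0 a))).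
  by rewrite /comp /g2 rmorph_compE g'K [RHS]map_mpolyX.
have -> : g2 w = mpolyC d (g0 (pi u0)).
  by rewrite /g2 rmorph_compE /w g'K [LHS]map_mpolyC.
by rewrite piu0 !rmorph0 eqxx.
Qed.

End CommutativeCancellation.

(** * Centres of polynomial algebras *)

Section Centres.
Variable (k : fieldType).

Definition cval (A : algType k) : {rmorphism centre_alg A -> A} := val.
Arguments cval {A}.

Lemma cvalC (A : algType k) (z : centre_alg A) a : cval z * a = a * cval z.
Proof. by have /asboolP := valP z. Qed.

Lemma cval_inj (A : algType k) : injective (@cval A).
Proof. exact: val_inj. Qed.

Lemma central_elt (A : algType k) (a : A) : (forall b, a * b = b * a) ->
  exists z : centre_alg A, a = cval z.
Proof. by move=> h; have ac : a \in @centre k A by [apply/asboolP]; exists (Sub a ac). Qed.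

Lemma map_cval_inj d (A : algType k) : injective (map_mpoly (n := d) (@cval A)).
Proof.
move=> p q e; apply/mpolyP => m; apply: cval_inj.
by rewrite -!mcoeff_map_mpoly e.
Qed.

Lemma mcoeff_mulC d (A : nzRingType) (p : mpoly d A) a m :
  mcoeff m (p * mpolyC d a) = mcoeff m p * a.
Proof.
elim/mpolyind: p => [|c m' p _ _ IH]; first by rewrite mul0r mcoeff0 mul0r.
rewrite mulrDl !mcoeffD mulrDl IH; congr (_ + _).
rewrite -mul_mpolyC -mulrA -(commr_mpolyX m' (mpolyC d a)) mulrA -rmorphM !mul_mpolyC.
by rewrite !mcoeffZ -!mulrA; congr (_ * _); rewrite mcoeffX; case: eqP; rewrite ?mulr1 ?mul1r ?mulr0 ?mul0r.
Qed.

Lemma map_cval_term d (A : algType k) c m (p : mpoly d (centre_alg A)) :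
  map_mpoly (@cval A) (c *: mpolyX _ m + p) =
  cval c *: mpolyX _ m + map_mpoly (@cval A) p.
Proof.
apply/mpolyP => m'; rewrite mcoeff_map_mpoly !mcoeffD !mcoeffZ !mcoeffX.
rewrite mcoeff_map_mpoly raddfD [X in X + _ = _]rmorphM; congr (_ * _ + _).
exact: rmorph_nat.
Qed.

Lemma map_cval_central d (A : algType k) (p : mpoly d (centre_alg A)) q :
  map_mpoly (@cval A) p * q = q * map_mpoly (@cval A) p.
Proof.
elim/mpolyind: p => [|c m p _ _ IH]; first by rewrite rmorph0 mul0r mulr0.
rewrite map_cval_term mulrDl mulrDr IH; congr (_ + _).
rewrite -mul_mpolyC -mulrA -(commr_mpolyX m q) !mulrA.
congr (_ * _); move: q {p IH}; elim/mpolyind => [|a m' q _ _ IHq]; first by rewrite mul0r mulr0.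
rewrite mulrDl mulrDr IHq; congr (_ + _).
rewrite -mul_mpolyC mulrA -mpolyCM cvalC mpolyCM -!mulrA; congr (_ * _).
exact: commr_mpolyX.
Qed.

Lemma central_mpoly d (A : algType k) (q : mpoly d A) :
  (forall a, q * mpolyC d a = mpolyC d a * q) ->
  exists p, q = map_mpoly (@cval A) p.
Proof.
move=> qc; have ex m : exists z : centre_alg A, mcoeff m q = cval z.
  by apply: central_elt => b; rewrite -mcoeff_mulC qc mcoeffCM.
have [cf cfE] := choice ex.
exists (\sum_(m <- msupp q) (cf m *: mpolyX _ m)).
rewrite [LHS]mpolyE; elim: (msupp q) => [|m r IH]; first by rewrite !big_nil rmorph0.
by rewrite !big_cons map_cval_term IH cfE.
Qed.

(** The centre of a polynomial algebra consists of the polynomials with central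
    coefficients. *)
Lemma centre_rmorph d (A B : algType k) (f : {rmorphism mpoly d A -> mpoly d B}) :
  (forall y, exists x, f x = y) ->
  exists g : {rmorphism mpoly d (centre_alg A) -> mpoly d (centre_alg B)},
    forall p, map_mpoly (@cval B) (g p) = f (map_mpoly (@cval A) p).
Proof.
move=> fsurj.
apply: (rmorph_of_graph (G := fun p q => map_mpoly (@cval B) q = f (map_mpoly (@cval A) p))).
- move=> p; have [|q ->] := @central_mpoly d B (f (map_mpoly (@cval A) p)); last by exists q.
  by move=> b; have [y <-] := fsurj (mpolyC d b); rewrite -!rmorphM map_cval_central.
- by move=> q; rewrite !rmorph0 => e; apply: map_cval_inj; rewrite e rmorph0.
- by rewrite !rmorph1.
- by move=> a x b y ea eb; rewrite !rmorphB /= ea eb.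
- by move=> a x b y ea eb; rewrite !rmorphM /= ea eb.
Qed.

(** Evaluation over a noncommutative algebra is multiplicative because the values
    are central. *)
Lemma central_eval d (A : algType k) (h : 'I_d -> centre_alg A) :
  exists e : {rmorphism mpoly d A -> A},
    [/\ forall a, e (mpolyC d a) = a, forall l, e (mvar l) = cval (h l)
      & forall p, e (map_mpoly (@cval A) p) = cval (mmap idfun h p)].
Proof.
pose e0 := mmap (idfun : {rmorphism A -> A}) (cval \o h).
have eM : monoid_morphism e0.
  have [M1 M2] : multiplicative e0.
    apply: commr_mmap_is_multiplicative => [l a|p m m'].
      by rewrite /GRing.comm /= cvalC.
    rewrite /mmap1; apply: (big_ind (fun x => GRing.comm _ x)) => /=.
    - exact: commr1.
    - by move=> x y; apply: commrM.
    - by move=> l _; apply: commrX; rewrite /GRing.comm cvalC.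
  by [].
pose eMM := GRing.isMonoidMorphism.Build _ _ e0 eM.
pose e : {rmorphism mpoly d A -> A} := HB.pack e0 eMM.
have eC a : e (mpolyC d a) = a by rewrite /e /= /e0 mmapC.
have eX l : e (mvar l) = cval (h l) by rewrite /e /= /e0 mmapX mmap1U.
exists e; split=> // p; rewrite -[LHS]rmorph_compE -[RHS]rmorph_compE; move: p.
apply: (mpoly_rmorph_ext (f := e \o map_mpoly (@cval A))) => [c|l].
  by rewrite !rmorph_compE mmap_constE [X in e X]map_mpolyC eC.
by rewrite !rmorph_compE mmap_varE [X in e X]map_mpolyX eX.
Qed.

Lemma ex_inverse (A B : nzRingType) (f : {rmorphism A -> B}) : bijective f ->
  exists g : {rmorphism B -> A}, cancel f g /\ cancel g f.
Proof.
move=> fb; have fI := bij_inj fb; have [f1 fK f1K] := fb.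
have [g gP] : exists g : {rmorphism B -> A}, forall b, (fun b a => f a = b) b (g b).
  apply: (rmorph_of_graph (G := fun b a => f a = b)).
  - by move=> b; exists (f1 b).
  - by move=> a e; apply: fI; rewrite e rmorph0.
  - by rewrite rmorph1.
  - by move=> a x b y ea eb; rewrite !rmorphB /= ea eb.
  - by move=> a x b y ea eb; rewrite !rmorphM /= ea eb.
by exists g; split=> x; [apply: fI|]; rewrite gP.
Qed.

End Centres.
Arguments cval {k A}.

Section Cancellation.
Variables (k : fieldType) (A B : algType k) (d : nat).
Variables (f : {rmorphism mpoly d A -> mpoly d B}).
Variables (f' : {rmorphism mpoly d B -> mpoly d A}).
Hypotheses (fK : cancel f f') (f'K : cancel f' f).
Hypothesis fC : forall c : k, f (mpolyC d c%:A) = mpolyC d c%:A.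
Hypothesis centre_f : forall z : centre_alg A, exists y : centre_alg B,
  f (mpolyC d (cval z)) = mpolyC d (cval y).
Hypothesis centre_f' : forall y : centre_alg B, exists z : centre_alg A,
  f' (mpolyC d (cval y)) = mpolyC d (cval z).

(** When the centres correspond, evaluating the variables of [B[s]] at the values
    [r] that they take at [t = 0] inverts the evaluation of [A[t]] at 0. *)
Lemma cancel_same_centre : alg_isomorphic A B.
Proof.
have [E0 [E0C E0X E0z]] := @central_eval k d A (fun=> 0).
have [g' g'E] : exists g' : {rmorphism mpoly d (centre_alg B) -> mpoly d (centre_alg A)},
    forall p, map_mpoly (@cval k A) (g' p) = f' (map_mpoly (@cval k B) p).
  by apply: centre_rmorph => y; exists (f y).
have [g gE] : exists g : {rmorphism mpoly d (centre_alg A) -> mpoly d (centre_alg B)},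
    forall p, map_mpoly (@cval k B) (g p) = f (map_mpoly (@cval k A) p).
  by apply: centre_rmorph => y; exists (f' y).
have mapX (D : algType k) l : map_mpoly (@cval k D) (mvar l) = mvar l :> mpoly d D.
  exact: map_mpolyX.
have [rho rhoE] : exists rho : 'I_d -> centre_alg A, forall l, E0 (f' (mvar l)) = cval (rho l).
  exists (fun l => mmap idfun (fun=> 0) (g' (mvar l))) => l.
  by rewrite -E0z g'E mapX.
have [r rE] := choice (fun l => centre_f (rho l)).
have [Er [ErC ErX Erz]] := @central_eval k d B r.
pose alpha : {rmorphism A -> B} := Er \o f \o @mpolyC d A.
pose beta : {rmorphism B -> A} := E0 \o f' \o @mpolyC d B.
have alphaE a : alpha a = Er (f (mpolyC d a)) by [].
have betaE b : beta b = E0 (f' (mpolyC d b)) by [].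
(* modulo the values of the variables, [f'] is [beta] and [f] is [alpha] *)
have h2 q : E0 (f' q) = beta (Er q).
  rewrite -rmorph_compE -[RHS]rmorph_compE; move: q.
  apply: mpoly_rmorph_ext => [c|l]; first by rewrite !rmorph_compE ErC.
  by rewrite [LHS]rmorph_compE [RHS]rmorph_compE ErX betaE -rE fK E0C rhoE.
have h1 p : Er (f p) = alpha (E0 p).
  rewrite -rmorph_compE -[RHS]rmorph_compE; move: p.
  apply: mpoly_rmorph_ext => [c|l]; first by rewrite !rmorph_compE E0C.
  rewrite [LHS]rmorph_compE [RHS]rmorph_compE E0X !rmorph0.
  have [z ez] : exists z : centre_alg B, Er (f (mvar l)) = cval z.
    by exists (mmap idfun r (g (mvar l))); rewrite -Erz gE mapX.
  have [y ey] := centre_f' z.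
  have : beta (cval z) = 0 by rewrite -ez -h2 fK E0X rmorph0.
  rewrite betaE ey E0C ez => y0.
  apply/eqP; rewrite -(mpolyC_eq0 d) -(f'K (mpolyC d (cval z))) ey y0.
  by rewrite !rmorph0.
have alphaZ : scalable alpha.
  move=> c a; rewrite -mulr_algl rmorphM -[RHS]mulr_algl; congr (_ * _).
  by rewrite alphaE fC ErC.
pose aZ := GRing.isScalable.Build _ _ _ _ alpha alphaZ.
pose alphaL : {lrmorphism A -> B} := HB.pack (GRing.RMorphism.sort alpha) aZ alpha.
exists alphaL; exists beta => [a|b].
  transitivity (beta (Er (f (mpolyC d a)))); first by [].
  by rewrite -h2 fK E0C.
transitivity (alpha (E0 (f' (mpolyC d b)))); first by [].
by rewrite -h1 f'K ErC.
Qed.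

End Cancellation.

Lemma algebra_ring_generators (k : fieldType) (A : algType k) :
  fg_algebra A -> exists l, ring_generators (in_alg A) l.
Proof.
move=> [s sgen]; exists s => S [S1 SB SM] Sc Ss; apply: sgen => //.
have S0 : 0 \in S by rewrite -(subrr (1 : A)) SB.
split=> // c x y xS yS; rewrite -mulr_algl -[y]opprK SB //; last by rewrite -[- y]sub0r SB.
by apply: SM => //; apply: Sc.
Qed.

Theorem not_cancellative_uniruled (k : closedFieldType) (A : algType k)
    (hprime : prime_algebra A) : infinite_field k -> fg_algebra (centre_alg A) ->
  ~ strongly_cancellative A -> uniruled (frac_centre_scalar hprime).
Proof.
move=> kinf hcentre nsc; apply: contrapT => nu; apply: nsc => d B d1 [f fb fC].
have kc : root_closed k := @closedField_root_closed k.
have [f' [fK f'K]] := ex_inverse fb.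
have [g gE] := centre_rmorph (fun y => ex_intro _ (f' y) (f'K y)).
have [g' g'E] := centre_rmorph (fun y => ex_intro _ (f y) (fK y)).
have gK : cancel g g' by move=> p; apply: map_cval_inj; rewrite g'E gE fK.
have g'K : cancel g' g by move=> p; apply: map_cval_inj; rewrite gE g'E f'K.
pose Z : idomainType := centre_domain hprime.
have [l lgen] := algebra_ring_generators hcentre.
have mapC (D : algType k) z : map_mpoly (@cval k D) (mpolyC d z) = mpolyC d (cval z).
  exact: map_mpolyC.
have gC c : g (mpolyC d c%:A) = mpolyC d c%:A.
  by apply: map_cval_inj; rewrite gE !mapC; apply: fC.
have gconst : forall z : Z, constant_mpoly (g (mpolyC d z)).
  apply: contrapT => nconst; apply: nu.
  exact: (@nonconstant_uniruled k Z (centre_alg B) d (in_alg Z) (in_alg (centre_alg B))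
            g g' gK g'K gC l kc kinf lgen nconst).
have g'const := @constants_onto Z (centre_alg B) d g g' gK g'K gconst.
apply: (cancel_same_centre fK f'K fC) => z.
  by have [y ey] := gconst z; exists y; rewrite -!mapC -ey gE.
by have [y ey] := g'const z; exists y; rewrite -!mapC -ey g'E.
Qed.

(** * Derivations *)

Definition is_derivation (F M : nzRingType) (f : F -> M) (D : F -> M) : Prop :=
  (forall a b, D (a + b) = D a + D b) /\
  (forall a b, D (a * b) = f a * D b + f b * D a).

Definition char0 (K : nzRingType) : Prop := forall n, (n.+1)%:R != 0 :> K.

Lemma char0_extension (K L : fieldType) (i : {rmorphism K -> L}) : char0 K -> char0 L.
Proof. by move=> K0 n; rewrite -(rmorph_nat i) fmorph_eq0. Qed.

Lemma deriv_eq0 (K : fieldType) (p : {poly K}) : char0 K -> p^`() = 0 ->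
  (size p <= 1)%N.
Proof.
move=> K0 e; apply/leq_sizeP => -[//|j] _.
have := congr1 (fun q : {poly K} => q`_j) e; rewrite coef_deriv coef0 -mulr_natr => /eqP.
by rewrite mulf_eq0 (negPf (K0 j)) orbF => /eqP.
Qed.

(** Minimal relations are separable in characteristic zero. *)
Lemma minimal_relation_deriv (D : comNzRingType) (M : fieldType)
    (s : {rmorphism D -> M}) y p : char0 M -> minimal_relation s y p ->
  eval_poly s y p^`() != 0.
Proof.
move=> M0 pm; have sp1 := minimal_relation_size pm; case: pm => py p0 sp pmin.
apply: contraTneq sp1 => py'.
have : map_poly s p^`() = 0.
  apply: pmin => //; apply: leq_ltn_trans (size_poly _ _) _.
  by rewrite lt_size_deriv //; apply: contraNneq p0 => ->; rewrite rmorph0.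
by rewrite -deriv_map => /(deriv_eq0 M0); rewrite sp -leqNgt.
Qed.

Lemma derivation0 (F M : nzRingType) (f : {rmorphism F -> M}) D :
  is_derivation f D -> D 0 = 0.
Proof.
by case=> DA _; apply: (addIr (D 0)); rewrite -DA !add0r.
Qed.

Lemma derivationN (F M : nzRingType) (f : {rmorphism F -> M}) D a :
  is_derivation f D -> D (- a) = - D a.
Proof.
move=> fD; apply/eqP; rewrite -addr_eq0; case: (fD) => DA _.
by rewrite -DA addNr (derivation0 fD).
Qed.

Lemma derivation_eval (F M : comNzRingType) (K : nzRingType) (f : {rmorphism F -> M})
    (D : F -> M) (u : {rmorphism K -> F}) a p : is_derivation f D ->
  (forall c, D (u c) = 0) ->
  D (eval_poly u a p) = f (eval_poly u a p^`()) * D a.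
Proof.
move=> fD Du; have [DA DM] := fD; elim/poly_ind: p => [|p c IH].
  by rewrite linear0 !rmorph0 (derivation0 fD) mul0r.
rewrite derivMXaddC rmorphD rmorphM eval_polyX eval_polyC DA DM Du addr0 IH.
by rewrite !rmorphD !rmorphM eval_polyX; ring.
Qed.

(** The kernel of a derivation is a subfield [K]; differentiating the minimal
    relation of an element over [K] shows that [K] is algebraically closed in [F]. *)
Lemma derivation_alg_zero (k F M : fieldType) (i : {rmorphism k -> F})
    (f : {rmorphism F -> M}) (D : F -> M) (s : seq F) : char0 F ->
  is_derivation f D -> (forall c, D (i c) = 0) ->
  (forall a, a \in s -> D a = 0) -> (forall a, dep i s a) -> forall a, D a = 0.
Proof.
move=> F0 fD Di Ds ds a; have [DA DM] := fD.
pose S : {pred F} := fun a => D a == 0.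
have SP b : b \in S -> D b = 0 by move/eqP.
have D1 : D 1 = 0 by rewrite -(rmorph1 i) Di.
have hS : GRing.divring_closed S.
  split; first exact/eqP.
    by move=> b c /SP b0 /SP c0; apply/eqP; rewrite DA (derivationN _ fD) b0 c0 subrr.
  move=> b c /SP b0 /SP c0; apply/eqP; rewrite DM b0 mulr0 addr0.
  have [->|cn] := eqVneq c 0; first by rewrite invr0 (derivation0 fD) mulr0.
  have : D (c * c^-1) = 0 by rewrite mulfV.
  rewrite DM c0 mulr0 addr0 => /eqP; rewrite mulf_eq0 fmorph_eq0 (negPf cn) => /eqP ->.
  by rewrite mulr0.
have [K [u uP]] := ex_subfield hS.
have Du c : D (u c) = 0 by apply: SP; apply/uP; exists c.
have [p pm] : exists p, minimal_relation u a p.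
  apply: ex_minimal_relation; apply: algebraic_trans (ds a) => d.
  have /uP[c ->] : ev i s d \in S; last exact: algebraic_image.
  apply: mmap_in => // [c|l]; first by apply/eqP/Di.
  by apply/eqP/Ds/mem_nth.
have := derivation_eval a p fD Du; have [-> _ _ _] := pm.
rewrite (derivation0 fD) => /esym/eqP; rewrite mulf_eq0 fmorph_eq0.
by rewrite (negPf (minimal_relation_deriv F0 pm)) => /eqP.
Qed.

(** The ring of dual numbers [a + b e], [e ^+ 2 = 0]: a derivation [d] of [R] is a
    section [a + d a e] of its projection. *)
Section DualNumbers.
Variable R : comNzRingType.

Definition dual : Type := (R * R)%type.
HB.instance Definition _ := GRing.Zmodule.on dual.

Definition dual_mul (x y : dual) : dual := (x.1 * y.1, x.1 * y.2 + y.1 * x.2).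
Definition dual_one : dual := (1, 0).

Fact dual_mulA : associative dual_mul.
Proof. by move=> x y z; congr pair; rewrite /=; ring. Qed.
Fact dual_mulC : commutative dual_mul.
Proof. by move=> x y; congr pair; rewrite /=; ring. Qed.
Fact dual_mul1 : left_id dual_one dual_mul.
Proof. by case=> a b; congr pair; rewrite /=; ring. Qed.
Fact dual_mulD : left_distributive dual_mul +%R.
Proof. by move=> x y z; congr pair; rewrite /=; ring. Qed.
Fact dual_one_neq0 : dual_one != 0.
Proof. by apply/eqP => -[/eqP]; rewrite oner_eq0. Qed.
HB.instance Definition _ := GRing.Zmodule_isComNzRing.Build dual
  dual_mulA dual_mulC dual_mul1 dual_mulD dual_one_neq0.

Lemma dualD (x y : dual) : x + y = (x.1 + y.1, x.2 + y.2).
Proof. by []. Qed.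
Lemma dualB (x y : dual) : x - y = (x.1 - y.1, x.2 - y.2).
Proof. by []. Qed.
Lemma dualM (x y : dual) : x * y = (x.1 * y.1, x.1 * y.2 + y.1 * x.2).
Proof. by []. Qed.
Lemma dual1 : 1 = (1, 0) :> dual. Proof. by []. Qed.

Definition dual_re (x : dual) : R := x.1.
Fact dual_re_zmod : zmod_morphism dual_re. Proof. by []. Qed.
Fact dual_re_monoid : monoid_morphism dual_re. Proof. by []. Qed.
HB.instance Definition _ := GRing.isZmodMorphism.Build dual R dual_re dual_re_zmod.
HB.instance Definition _ := GRing.isMonoidMorphism.Build dual R dual_re dual_re_monoid.

End DualNumbers.

Lemma dual_regular (M : fieldType) (x y : dual M) : x.1 != 0 -> x * y = 0 -> y = 0.
Proof.
case: x y => [a b] [c d] /= a0; rewrite dualM => -[/= /eqP].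
rewrite mulf_eq0 (negPf a0) /= => /eqP -> /eqP; rewrite mul0r addr0.
by rewrite mulf_eq0 (negPf a0) /= => /eqP ->.
Qed.

Lemma derivation_dual (R Q : comNzRingType) (f : {rmorphism R -> Q}) (D : R -> Q) :
  is_derivation f D ->
  exists g : {rmorphism R -> dual Q}, forall a, g a = (f a, D a).
Proof.
move=> fD; have [DA DM] := fD.
apply: (rmorph_of_graph (G := fun a (w : dual Q) => w = (f a, D a))).
- by move=> a; eexists.
  - by move=> _ ->; rewrite rmorph0 (derivation0 fD).
  - rewrite rmorph1 dual1; congr pair; apply: (addIr (D 1)).
    by rewrite add0r -{1}(mulr1 1) DM rmorph1 !mul1r.
  - by move=> a _ b _ -> ->; rewrite dualB /= rmorphB DA (derivationN _ fD).
  - by move=> a _ b _ -> ->; rewrite dualM /= rmorphM DM.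
Qed.

Lemma dual_derivation (R Q : comNzRingType) (f : {rmorphism R -> Q})
    (g : {rmorphism R -> dual Q}) : (forall a, (g a).1 = f a) ->
  is_derivation f (fun a => (g a).2).
Proof.
move=> gf; split=> a b; first by rewrite rmorphD.
by rewrite rmorphM dualM /= !gf.
Qed.

Section DualEvaluation.
Variables (D Q : comNzRingType) (s : {rmorphism D -> Q}) (f : {rmorphism D -> dual Q}).
Hypothesis f1 : forall d, (f d).1 = s d.

Lemma dual_eval1 z q : (eval_poly f z q).1 = eval_poly s z.1 q.
Proof.
elim/poly_ind: q => [|q c IH]; first by rewrite !rmorph0.
rewrite rmorphD rmorphM eval_polyX eval_polyC dualD dualM /= IH f1.
by rewrite rmorphD rmorphM eval_polyX eval_polyC.
Qed.

Lemma dual_eval2 y e q : (eval_poly f (y, e) q).2 =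
  (eval_poly f (y, 0) q).2 + e * eval_poly s y q^`().
Proof.
elim/poly_ind: q => [|q c IH]; first by rewrite linear0 !rmorph0 mulr0 addr0.
pose f' e := eval_poly f (y, e); have f'E e' : eval_poly f (y, e') = f' e' by [].
have f'D e' : f' e' (q * 'X + c%:P) = f' e' q * (y, e') + f c.
  by rewrite /f' rmorphD rmorphM eval_polyX eval_polyC.
have f'1 e' : (f' e' q).1 = eval_poly s y q by rewrite dual_eval1.
have IH' : (f' e q).2 = (f' 0 q).2 + e * eval_poly s y q^`() := IH.
rewrite !f'E !f'D !dualD !dualM /= !f'1 IH' derivMXaddC rmorphD rmorphM eval_polyX.
by ring.
Qed.

End DualEvaluation.

(** A derivation being a morphism to dual numbers, it extends along algebraic
    elements just as points do. The real part of the value of [y] is [y], and its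
    infinitesimal part is the solution of a linear equation whose coefficient, the
    derivative of the minimal relation at [y], is not zero. *)
Lemma dual_extension (M : fieldType) (l : seq M) (D : comNzRingType)
    (s : {rmorphism D -> M}) (f : {rmorphism D -> dual M}) : char0 M ->
  (forall d, (f d).1 = s d) -> compatible s f -> (forall a, a \in l -> algebraic s a) ->
  exists (D' : comNzRingType) (c : {rmorphism D -> D'}) (s' : {rmorphism D' -> M})
      (f' : {rmorphism D' -> dual M}),
    [/\ forall d, s' (c d) = s d /\ f' (c d) = f d, forall d, (f' d).1 = s' d,
        compatible s' f' & forall a, a \in l -> exists d, a = s' d].
Proof.
move=> M0; elim: l D s f => [|y l IH] D s f f1 sf la.
  by exists D, idfun, s, f.
have [p pm] : exists p, minimal_relation s y p.
  by apply: ex_minimal_relation; apply: la; rewrite mem_head.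
have py' := minimal_relation_deriv M0 pm; have [py _ _ _] := pm.
pose e := - (eval_poly f (y, 0) p).2 / eval_poly s y p^`().
pose z : dual M := (y, e).
have pz : eval_poly f z p = 0.
  apply/eqP; rewrite -[_ == _]/((_ == _) && (_ == _)) (dual_eval1 f1) /= py eqxx /=.
  by rewrite (dual_eval2 f1) /e divfK // subrr.
have C : compatible (eval_poly s y) (eval_poly f z).
  apply: (compatible_algebraic sf pm pz) => q.
  by apply: dual_regular; rewrite f1; apply: minimal_relation_lead pm.
have la' a : a \in l -> algebraic (eval_poly s y) a.
  move=> al; apply: algebraic_trans (la a _) => [d|]; last by rewrite inE al orbT.
  by rewrite -(eval_polyC s y d); apply: algebraic_image.
have [D' [c [s' [f' [cE f'1 C' l']]]]] := IH _ _ _ (dual_eval1 f1 z) C la'.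
exists D', (c \o polyC), s', f'; split=> // [d|a].
  by rewrite rmorph_compE; have [-> ->] := cE d%:P; rewrite !eval_polyC.
case/predU1P => [->|/l'] //; exists (c 'X).
by have [-> _] := cE 'X; rewrite eval_polyX.
Qed.

(** The quotient rule, as divisibility in the dual numbers by elements whose real
    part is not zero. *)
Lemma dual_fractions (M : fieldType) (D : comNzRingType) (s : {rmorphism D -> M})
    (f : {rmorphism D -> dual M}) : (forall d, (f d).1 = s d) -> compatible s f ->
  (forall a, a \in fractions s) ->
  exists g : {rmorphism M -> dual M},
    (forall a, (g a).1 = a) /\ (forall d, g (s d) = f d).
Proof.
move=> f1 sf all.
pose G (a : M) (w : dual M) := exists p q, [/\ s q != 0, a = s p / s q & w * f q = f p].
have [g gP] : exists g : {rmorphism M -> dual M}, forall a, G a (g a).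
  apply: rmorph_of_graph.
  - move=> a; have /fractionsP[p [q [q0 ea]]] := all a.
    pose w1 := a; pose w2 := ((f p).2 - a * (f q).2) / s q.
    exists (w1, w2), p, q; split=> //; rewrite dualM /= f1 /w1 /w2 ea.
    rewrite [RHS]surjective_pairing f1; congr pair; first by rewrite divfK.
    by rewrite [s q * _]mulrC divfK // addrC subrK.
  - move=> w [p [q [q0 /esym/eqP]]]; rewrite mulf_eq0 invr_eq0 (negPf q0) orbF.
    move=> /eqP/sf ->; rewrite mulrC; apply: dual_regular; by rewrite f1.
  - by exists 1, 1; rewrite !rmorph1 oner_neq0 divr1 mulr1.
  - move=> a w b w' [p [q [q0 -> e]]] [p' [q' [q0' -> e']]].
    exists (p * q' - p' * q), (q * q').
    rewrite !rmorphM mulf_neq0 // !rmorphB !rmorphM subf_div //; split=> //.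
    by rewrite -e -e'; ring.
  - move=> a w b w' [p [q [q0 -> e]]] [p' [q' [q0' -> e']]].
    exists (p * p'), (q * q').
    rewrite !rmorphM mulf_neq0 // mulf_div; split=> //.
    by rewrite -e -e'; ring.
exists g; split=> [a|d].
  have [p [q [q0 ea /(congr1 fst)]]] := gP a; rewrite dualM /= !f1 => e.
  by apply: (mulIf q0); rewrite e [in RHS]ea divfK.
have [p [q [q0 e e']]] := gP (s d).
apply/eqP; rewrite -subr_eq0; apply/eqP; apply: (@dual_regular _ (f q)); first by rewrite f1.
rewrite mulrBr [f q * g _]mulrC e' -rmorphM -rmorphB; apply: sf.
by rewrite rmorphB rmorphM e mulrC divfK // subrr.
Qed.

Lemma partial_derivation (k E : fieldType) (j : {rmorphism k -> E}) (l s : seq E)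
    (b : 'I_(size s)) : char0 E -> field_generators j l -> transcendence_basis j s ->
  exists D : E -> E, [/\ is_derivation idfun D, forall c, D (j c) = 0
    & forall a : 'I_(size s), D s`_a = (a == b)%:R].
Proof.
move=> E0 lgen [fs ds].
have [jd jdE] : exists jd : {rmorphism k -> dual E}, forall c, jd c = (j c, 0).
  by apply: (derivation_dual (f := j)); split=> *; rewrite ?addr0 ?mulr0 ?addr0.
pose f : {rmorphism mpoly (size s) k -> dual E} :=
  mmap jd (fun a : 'I_(size s) => (s`_a, (a == b)%:R) : dual E).
have f1 d : (f d).1 = ev j s d.
  have -> : (f d).1 = dual_re (mmap jd (fun a : 'I_(size s) => (s`_a, (a == b)%:R) : dual E) d).
    by [].
  by rewrite rmorph_mmap; congr (mmap _ _ d); apply/funext => c; rewrite /= ?jdE.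
have sf : compatible (ev j s) f by move=> p /fs ->; rewrite rmorph0.
have [D' [c [s' [f' [cE f'1 C' l']]]]] := dual_extension (l := l) E0 f1 sf (fun a _ => ds a).
have all a : a \in fractions s'.
  move: a; apply: lgen; first exact: fractions_divring.
    by move=> a; rewrite -(evC j s); have [<- _] := cE (mpolyC _ a); apply: fractions_image.
  by move=> a /l'[d ->]; apply: fractions_image.
have [g [g1 gE]] := dual_fractions f'1 C' all.
have gs d : g (ev j s d) = f d by have [<- <-] := cE d; rewrite gE.
exists (fun a => (g a).2); split.
- exact: (dual_derivation (f := idfun)).
- by move=> a; rewrite -(evC j s) gs /f mmap_constE jdE.
- by move=> a; rewrite -(evX j) gs /f mmap_varE.
Qed.

(** * Lines through a projective model *)

Lemma mmap_homogeneous (k A : comNzRingType) (i : {rmorphism k -> A}) n e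
    (c : A) (h : 'I_n -> A) (p : mpoly n k) : p \is ishomog1 e mdeg ->
  mmap i (fun l => c * h l) p = c ^+ e * mmap i h p.
Proof.
move=> /allP hp; rewrite /mmap mulr_sumr big_seq [RHS]big_seq; apply: eq_bigr => m /hp /eqP em.
rewrite mulrCA; congr (_ * _); rewrite /mmap1.
rewrite (eq_bigr (fun l => c ^+ m l * h l ^+ m l)); last by move=> l _; rewrite exprMn.
rewrite big_split /=; congr (_ * _); rewrite -em.
by rewrite prodrXr; congr (_ ^+ _); rewrite -[RHS]/(mdeg m) mdegE.
Qed.

Lemma quotient_rule (M : fieldType) (p q r r' x : M) : q != 0 ->
  r = p / q * r' + q * x -> x = (r * q - p * r') / (q * q).
Proof. by move=> q0 ->; field. Qed.

Section Chart.
Variables (E M : fieldType) (cst : {rmorphism E -> M}) (t : M).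

(** The function field [M] of the line over [E] is seen through the polynomials in
    a coordinate, which will be both [t] and its inverse. *)
Local Notation chart := (eval_poly cst t).

Hypothesis chart_inj : forall p, chart p = 0 -> p = 0.
Hypothesis chart_frac : forall a, a \in fractions chart.

Lemma chart_neq0 p : p != 0 -> chart p != 0.
Proof. by apply: contra_neq => /chart_inj. Qed.

Lemma chart_derivation (D : M -> M) (d : E -> E) c : is_derivation idfun D ->
  (forall e, D (cst e) = cst (d e)) -> D t = chart c ->
  forall q, exists r, D (chart q) = chart r.
Proof.
move=> [DA DM] De Dt q; elim/poly_ind: q => [|q e [r er]].
  by exists (d 0)%:P; rewrite [RHS]eval_polyC -De !rmorph0.
exists (q * c + 'X * r + (d e)%:P).
by rewrite !rmorphD !rmorphM !eval_polyX !eval_polyC DA DM er De Dt.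
Qed.

Lemma minimal_relation_dvd (L : fieldType) (io : {rmorphism E -> L}) z d p :
  minimal_relation io z d -> eval_poly io z p = 0 -> d %| p.
Proof.
move=> [dz d0 sd dmin] pz; apply/modp_eq0P; apply/eqP; rewrite -(map_poly_eq0 io).
have dn0 : d != 0 by rewrite -(map_poly_eq0 io).
apply/eqP; apply: dmin; last by rewrite size_map_poly ltn_modp.
by have := pz; rewrite {1}(divp_eq p d) rmorphD rmorphM dz mulr0 add0r.
Qed.

(** The common factor is the minimal polynomial of [z]. *)
Lemma common_factor (L : fieldType) (io : {rmorphism E -> L}) z p :
  p != 0 -> eval_poly io z p = 0 -> exists d : {poly E}, (1 < size d)%N /\
    forall q, eval_poly io z q = 0 -> exists r, q = r * d.
Proof.
move=> p0 pz; have [d dm] : exists d, minimal_relation io z d.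
  by apply: ex_minimal_relation; exists p; rewrite ?map_poly_eq0.
exists d; split; first exact: minimal_relation_size dm.
by move=> q /(minimal_relation_dvd dm)/dvdpP.
Qed.

Section Place.
Variables (L : fieldType) (io : {rmorphism E -> L}) (z : L).

(** The local ring of the line at the point [z] of an extension of [E]. *)
Definition regular_at (a : M) : Prop :=
  exists p q, eval_poly io z q != 0 /\ a = chart p / chart q.

Lemma nonvanishing_neq0 q : eval_poly io z q != 0 -> chart q != 0.
Proof. by move=> qz; apply: chart_neq0; apply: contraNneq qz => ->; rewrite rmorph0. Qed.

Lemma regular_chart p : regular_at (chart p).
Proof. by exists p, 1; rewrite !rmorph1 oner_neq0 divr1. Qed.

Lemma regularB a b : regular_at a -> regular_at b -> regular_at (a - b).
Proof.
move=> [p [q [q0 ->]]] [p' [q' [q0' ->]]]; exists (p * q' - p' * q), (q * q').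
by rewrite !rmorphB !rmorphM mulf_neq0 // subf_div ?nonvanishing_neq0.
Qed.

Lemma regular0 : regular_at 0.
Proof. by rewrite -(rmorph0 chart); apply: regular_chart. Qed.

Lemma regular1 : regular_at 1.
Proof. by rewrite -(rmorph1 chart); apply: regular_chart. Qed.

Lemma regularD a b : regular_at a -> regular_at b -> regular_at (a + b).
Proof.
move=> ra rb; rewrite -[b]opprK; apply: regularB => //.
by rewrite -sub0r; apply: regularB => //; apply: regular0.
Qed.

Lemma regularM a b : regular_at a -> regular_at b -> regular_at (a * b).
Proof.
move=> [p [q [q0 ->]]] [p' [q' [q0' ->]]]; exists (p * p'), (q * q').
by rewrite !rmorphM mulf_neq0 // mulf_div.
Qed.

Lemma regular_derivation (D : M -> M) a : is_derivation idfun D ->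
  (forall q, exists r, D (chart q) = chart r) -> regular_at a -> regular_at (D a).
Proof.
move=> [_ DM] Dc [p [q [qz ->]]]; have q0 := nonvanishing_neq0 qz.
have [r er] := Dc p; have [r' er'] := Dc q.
exists (r * q - p * r'), (q * q); rewrite rmorphM mulf_neq0 //; split=> //.
have := DM (chart p / chart q) (chart q); rewrite divfK // er er' /= => e.
by rewrite rmorphB !rmorphM; apply: quotient_rule.
Qed.

(** Homogeneous coordinates on the line, without common zero at [z]: one divides by
    the minimal polynomial of [z] as long as possible. *)
Lemma normalize n (y : 'I_n -> M) : (exists l, y l != 0) ->
  exists (c : M) (x : 'I_n -> {poly E}),
    [/\ c != 0, forall l, y l = c * chart (x l) & exists l, eval_poly io z (x l) != 0].
Proof.
move=> [l0 y0].
pose P (x : 'I_n -> {poly E}) := exists2 c, c != 0 & forall l, y l = c * chart (x l).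
have exP : exists x, P x.
  have [pq pqE] := choice (fun l => elimT (fractionsP chart (y l)) (chart_frac (y l))).
  have [q qE] := choice pqE.
  pose Q := \prod_l q l.
  have Q0 : chart Q != 0.
    by rewrite rmorph_prod; apply/prodf_neq0 => l _; have [] := qE l.
  exists (fun l => pq l * \prod_(l' | l' != l) q l'); exists (chart Q)^-1; first by rewrite invr_eq0.
  move=> l; have [ql ->] := qE l; apply: (mulfI Q0); rewrite mulVKf // rmorphM.
  by rewrite {1}/Q (bigD1 l) //= rmorphM mulrAC mulrCA mulfV // mulr1.
have [x [[c c0 yx] xmin]] := ex_min_size (fun x : 'I_n -> {poly E} => size (x l0)) exP.
exists c, x; split=> //; apply: contrapT => nv.
have xz l : eval_poly io z (x l) = 0.
  by apply: contrapT => /eqP h; apply: nv; exists l.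
have x0 : x l0 != 0 by apply: contraNneq y0 => e; rewrite yx e rmorph0 mulr0.
have [d [d1 dvd]] := common_factor x0 (xz l0).
have [r rE] := choice (fun l => dvd _ (xz l)).
have d0 : d != 0 by rewrite -size_poly_gt0 ltnW.
have : P r.
  exists (c * chart d); first by rewrite mulf_neq0 // chart_neq0.
  by move=> l; rewrite yx rE rmorphM -mulrA [chart d * _]mulrC.
move/xmin; rewrite rE; have r0 : r l0 != 0.
  by apply: contraNneq x0 => e; rewrite rE e mul0r.
have aux a b : (0 < a -> 1 < b -> (a + b).-1 <= a -> False)%N by lia.
by rewrite size_mul //; apply: aux; rewrite // size_poly_gt0.
Qed.

End Place.

(** In a reduced fraction the denominator has no root, in any extension of [E],
    because the numerator would share it. *)
Lemma regular_everywhere a :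
  (forall (L : fieldType) (io : {rmorphism E -> L}) z, regular_at io z a) ->
  exists p, a = chart p.
Proof.
move=> rega; pose P (pq : {poly E} * {poly E}) := pq.2 != 0 /\ a = chart pq.1 / chart pq.2.
have exP : exists pq, P pq.
  have /fractionsP[p [q [q0 ea]]] := chart_frac a; exists (p, q); split=> //=.
  by apply: contraNneq q0 => ->; rewrite rmorph0.
have [[p q] [[/= q0 ea] qmin]] := ex_min_size (fun pq : {poly E} * {poly E} => size pq.2) exP.
have [q1|q1] := leqP (size q) 1.
  have [e eq] : exists e, q = e%:P by exists q`_0; apply: size1_polyC.
  have e0 : cst e != 0 by move: (chart_neq0 q0); rewrite eq eval_polyC.
  exists (e^-1 *: p); rewrite ea eq eval_polyC -mul_polyC rmorphM eval_polyC.
  by rewrite fmorphV mulrC.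
have [L [io [z /eqP qz]]] := ex_root_extension q1.
have [p' [q' [q'z ea']]] := rega L io z.
have q'0 := nonvanishing_neq0 q'z.
have epq : p * q' = p' * q.
  apply/eqP; rewrite -subr_eq0; apply/eqP/chart_inj; rewrite rmorphB !rmorphM.
  apply/eqP; rewrite subr_eq0 -eqr_div ?(chart_neq0 q0) //; apply/eqP.
  by rewrite -ea -ea'.
have pz : eval_poly io z p = 0.
  apply: (mulIf q'z); rewrite -rmorphM epq rmorphM mul0r.
  by rewrite [eval_poly io z q]qz mulr0.
have [d [d1 dvd]] := common_factor q0 qz.
have [rp ep] := dvd _ pz; have [rq eq] := dvd _ qz.
have d0 : d != 0 by rewrite -size_poly_gt0 ltnW.
have rq0 : rq != 0 by apply: contraNneq q0 => e; rewrite eq e mul0r.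
have /qmin /= : P (rp, rq).
  split=> //=; rewrite ea ep eq !rmorphM -mulf_div divff ?mulr1 //.
  exact: chart_neq0.
have aux x y : (0 < x -> 1 < y -> (x + y).-1 <= x -> False)%N by lia.
rewrite eq size_mul // => h; exfalso; by apply: aux h; rewrite ?size_poly_gt0.
Qed.

End Chart.

Section ClosedPoint.
Variables (k : closedFieldType) (kinf : infinite_field k).
Variables (F E M : fieldType) (i : {rmorphism k -> F}) (j : {rmorphism k -> E}).
Variables (cst : {rmorphism E -> M}) (t : M) (f : {rmorphism F -> M}).
Hypothesis chart_inj : forall p, eval_poly cst t p = 0 -> p = 0.
Hypothesis chart_frac : forall a, a \in fractions (eval_poly cst t).
Hypothesis fi : forall c, f (i c) = cst (j c).

(** This is the Nullstellensatz: the theorem [specialization] with base ring [k],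
    whose algebraic closedness keeps the values in [k]. *)
Lemma specialize_coordinates (L : fieldType) (u : {rmorphism k -> L}) n (y : 'I_n -> L) :
  exists P : 'I_n -> k, forall g, mmap u y g = 0 -> meval P g = 0.
Proof.
have [D [c [s [sc sl H]]]] := specialization [seq y a | a <- enum 'I_n] u.
have yd a : exists d, y a = s d by apply: sl; apply: map_f; rewrite mem_enum.
have [d dE] := choice yd.
have s1 : s 1 != 0 by rewrite rmorph1 oner_neq0.
have [u1 [u10 Hu]] := H 1 s1.
have uC : compatible u (idfun : {rmorphism k -> k}).
  by move=> b /eqP; rewrite fmorph_eq0 => /eqP.
have u1n : (idfun : {rmorphism k -> k}) u1 != 0.
  by apply: contraNneq u10 => /= ->; rewrite rmorph0.
have [L1 [i1 [f1 [C f1c _ i1S]]]] := Hu k idfun kinf uC u1n.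
have [P PE] := choice (fun a => i1S (@closedField_root_closed k) (f1 (d a))).
exists P => g yg; apply/eqP; rewrite -(fmorph_eq0 i1); apply/eqP.
have -> : i1 (meval P g) = f1 (mmap c d g).
  rewrite /meval !rmorph_mmap; congr (mmap _ _ g); apply/funext => a.
    by rewrite /= f1c.
  by rewrite /= -PE.
apply: C; rewrite -[RHS]yg rmorph_mmap; congr (mmap _ _ g); apply/funext => a.
  by rewrite /= sc.
by rewrite /= dE.
Qed.

(** Common factors of the homogeneous coordinates can be removed, so that the map
    from the line to the model is defined at [z]. The closed point [P] is a
    specialization of the image of [z], whose local ring contains that of [P]. *)
Lemma place_closed_point N (x : 'I_N.+1 -> F) (L : fieldType)
    (io : {rmorphism E -> L}) (z : L) : (exists l, x l != 0) ->
  exists P, closed_point i x P /\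
    forall y, local_ring i x P y -> regular_at cst t io z (f y).
Proof.
move=> [l0 x0]; pose s := eval_poly cst t.
have [|c [x' [c0 fx [l1 x1]]]] := @normalize _ _ cst t chart_inj chart_frac _ io z _ (fun l => f (x l)).
  by exists l0; rewrite fmorph_eq0.
pose xi l := eval_poly io z (x' l).
pose zeta l := xi l / xi l1.
have [P PE] := specialize_coordinates (io \o j) zeta.
pose val g := mmap (polyC \o j) x' g.
have fval g e : homogeneous e g -> f (mmap i x g) = c ^+ e * s (val g).
  move=> hg; rewrite rmorph_mmap.
  have -> : mmap (f \o i) (f \o x) g = mmap (cst \o j) (fun l => c * s (x' l)) g.
    by congr (mmap _ _ g); apply/funext => a; rewrite /= ?fi ?fx.
  rewrite (mmap_homogeneous _ _ _ hg); congr (_ * _).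
  rewrite /s /val rmorph_mmap; congr (mmap _ _ g); apply/funext => a.
  by rewrite /= eval_polyC.
have zval g e : homogeneous e g ->
    eval_poly io z (val g) = xi l1 ^+ e * mmap (io \o j) zeta g.
  move=> hg; rewrite -(mmap_homogeneous _ _ _ hg) /val rmorph_mmap.
  congr (mmap _ _ g); apply/funext => a; first by rewrite /= eval_polyC.
  by rewrite /= /zeta mulrCA mulfV // mulr1.
exists P; split; first split.
- exists l1; have : meval P (mvar l1 - mpolyC _ 1) = 0.
    apply: PE; rewrite rmorphB /= mmapX mmap1U mmapC /= !rmorph1 /zeta mulfV //.
    by rewrite subrr.
  rewrite rmorphB /= mevalXU mevalC => /eqP; rewrite subr_eq0 => /eqP ->.
  exact: oner_neq0.
- move=> e g hg xg; apply: PE.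
  have : eval_poly io z (val g) = 0.
    rewrite (chart_inj (p := val g)) ?rmorph0 //.
    apply: (mulfI (expf_neq0 e c0)); rewrite mulr0 -(fval _ _ hg) xg.
    by rewrite rmorph0.
  by rewrite (zval _ _ hg) => /eqP; rewrite mulf_eq0 expf_eq0 (negPf x1) andbF => /eqP.
move=> y [e [g [h [hg hh hP ->]]]].
have hz : eval_poly io z (val h) != 0.
  rewrite (zval _ _ hh) mulf_neq0 ?expf_neq0 //.
  by apply: contraNneq hP => /PE ->.
exists (val g), (val h); split=> //.
rewrite fmorph_div (fval _ _ hg) (fval _ _ hh) -mulf_div divff ?mul1r //.
exact: expf_neq0.
Qed.

End ClosedPoint.

(** * Pluricanonical forms on uniruled models *)

Lemma derivation_sum (F M : comNzRingType) (f : {rmorphism F -> M}) n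
    (D : 'I_n -> F -> M) (c : 'I_n -> M) : (forall p, is_derivation f (D p)) ->
  is_derivation f (fun a => \sum_p c p * D p a).
Proof.
move=> fD; split=> a b.
  by rewrite -big_split; apply: eq_bigr => p _; case: (fD p) => -> _; rewrite mulrDr.
rewrite !mulr_sumr -big_split; apply: eq_bigr => p _; case: (fD p) => _ ->.
by rewrite mulrDr !(mulrCA (c p)).
Qed.

Section Frames.
Variables (k : closedFieldType) (F : fieldType) (i : {rmorphism k -> F}).
Variables (F0 : char0 F) (n : nat).
Variables (tau : seq F) (taun : size tau = n) (taub : transcendence_basis i tau).
Variable (D : 'I_n -> derivation i).

Let B : 'M[F]_n := \matrix_(p, q) D p tau`_q.

Lemma der_derivation (d : derivation i) : is_derivation (idfun : {rmorphism F -> F}) d.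
Proof. by split=> a b; [apply: Defs.der_add|apply: Defs.der_mul]. Qed.

Lemma in_tau (P : F -> Prop) : (forall q : 'I_n, P tau`_q) -> forall a, a \in tau -> P a.
Proof.
move=> h a /(nthP 0)[q qs <-]; rewrite taun in qs.
exact: (h (Ordinal qs)).
Qed.

(** A linear combination of the derivations [D] that kills the transcendence basis
    [tau] is zero, hence kills [a]. *)
Lemma frame_det (a : 'I_n -> F) : wedge_diff a D != 0 -> \det B != 0.
Proof.
apply: contra => /det0P[v v0 vB]; apply/det0P; exists v => //.
pose d b := \sum_p v 0 p * D p b.
have d0 b : d b = 0.
  apply: (derivation_alg_zero (f := idfun) (i := i) (s := tau)) (F0) _ _ _ (proj2 taub) b.
  - exact: derivation_sum (fun p => der_derivation (D p)).
  - by move=> c; apply: big1 => p _; rewrite Defs.der_scalar mulr0.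
  - apply: (in_tau (P := fun a => d a = 0)) => q; have := congr1 (fun u : 'rV_n => u 0 q) vB; rewrite !mxE => e.
    by rewrite -[RHS]e; apply: eq_bigr => p _; rewrite mxE.
by apply/rowP => q; rewrite !mxE -[RHS](d0 (a q)); apply: eq_bigr => p _; rewrite mxE.
Qed.

Hypothesis B0 : \det B != 0.
Variables (M : fieldType) (f : {rmorphism F -> M}).
Variables (T : 'I_n -> F -> M).
Hypotheses (fT : forall p, is_derivation f (T p)) (T0 : forall p c, T p (i c) = 0).

(** The determinant of the frame [T] in terms of the derivations [D]; the quotient
    of two determinants avoids introducing the dual basis of [tau]. *)
Definition frame_ratio : M := \det (\matrix_(p, q) T p tau`_q) / f (\det B).

Lemma frame_change (a : 'I_n -> F) :
  \det (\matrix_(p, q) T p (a q)) = frame_ratio * f (wedge_diff a D).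
Proof.
pose A : 'M[M]_n := \matrix_(p, q) T p tau`_q; pose Bf := map_mx f B.
have Bfu : Bf \in unitmx by rewrite unitmxE det_map_mx unitfE fmorph_eq0.
pose mu := A *m invmx Bf.
have TE p b : T p b = \sum_s mu p s * f (D s b).
  apply/eqP; rewrite -subr_eq0; apply/eqP; move: b.
  pose g s (b : F) := f (D s b).
  have gd s : is_derivation f (g s).
    split=> x y; rewrite /g; first by rewrite Defs.der_add rmorphD.
    by rewrite Defs.der_mul rmorphD !rmorphM.
  have sd := derivation_sum (mu p) gd.
  apply: (derivation_alg_zero (f := f) (i := i) (s := tau)) (F0) _ _ _ (proj2 taub).
  - split=> x y; have [TA TM] := fT p; have [sA sM] := sd.
      by rewrite TA sA opprD addrACA.
    by rewrite TM sM !mulrBr opprD addrACA.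
  - by move=> c; rewrite T0 big1 ?subrr // => s _; rewrite Defs.der_scalar rmorph0 mulr0.
  - apply: (in_tau (P := fun a => T p a - \sum_s mu p s * g s a = 0)) => q.
    apply/eqP; rewrite subr_eq0; apply/eqP.
    have := congr1 (fun u : 'M[M]_n => u p q) (mulmxKV Bfu A); rewrite !mxE => <-.
    by apply: eq_bigr => s _; rewrite !mxE.
have -> : \matrix_(p, q) T p (a q) = mu *m map_mx f (\matrix_(s, q) D s (a q)).
  by apply/matrixP => p q; rewrite !mxE TE; apply: eq_bigr => s _; rewrite !mxE.
by rewrite det_mulmx det_map_mx det_mulmx det_inv det_map_mx.
Qed.

Lemma pullback_form m (w : rational_form i n) (r : nat) (g : 'I_r -> F)
    (a : 'I_r -> 'I_m -> 'I_n -> F) :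
  (forall D', w D' = \sum_(l < r) g l * \prod_(j < m) wedge_diff (a l j) D') ->
  frame_ratio ^+ m * f (w D) =
  \sum_(l < r) f (g l) * \prod_(j < m) \det (\matrix_(p, q) T p (a l j q)).
Proof.
move=> ->; rewrite rmorph_sum mulr_sumr; apply: eq_bigr => l _.
rewrite rmorphM rmorph_prod mulrCA; congr (_ * _).
rewrite [RHS](eq_bigr (fun j => frame_ratio * f (wedge_diff (a l j) D))); last first.
  by move=> j _; apply: frame_change.
by rewrite big_split /= prodr_const card_ord.
Qed.

End Frames.

Section Regularity.
Variables (k : closedFieldType) (kinf : infinite_field k).
Variables (F E M : fieldType) (i : {rmorphism k -> F}) (j : {rmorphism k -> E}).
Variables (cst : {rmorphism E -> M}) (t : M) (f : {rmorphism F -> M}).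
Hypothesis chart_inj : forall p, eval_poly cst t p = 0 -> p = 0.
Hypothesis chart_frac : forall a, a \in fractions (eval_poly cst t).
Hypothesis fi : forall c, f (i c) = cst (j c).
Variables (F0 : char0 F) (n : nat) (tau : seq F) (taun : size tau = n).
Variables (taub : transcendence_basis i tau) (D : 'I_n -> derivation i).
Hypothesis B0 : \det (\matrix_(p, q) D p tau`_q) != 0.
Variables (T : 'I_n -> M -> M).
Hypotheses (Td : forall p, is_derivation idfun (T p)).
Hypotheses (T0 : forall p c, T p (cst (j c)) = 0).
Hypothesis Tc : forall p q, exists r, T p (eval_poly cst t q) = eval_poly cst t r.
Variables (N m : nat) (x : 'I_N.+1 -> F) (x0 : exists l, x l != 0).
Variables (w : rational_form i n) (wc : pluricanonical x m w).

(** Near [P] the form is an expression in regular functions and their derivatives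
    along the frame, and the frame preserves regularity; the value does not depend
    on the expression chosen at [P], by [pullback_form]. *)
Lemma pullback_polynomial : exists p,
  frame_ratio tau D f (fun p a => T p (f a)) ^+ m * f (w D) = eval_poly cst t p.
Proof.
apply: regular_everywhere => // L io z.
have [P [Pc Py]] := place_closed_point kinf chart_inj chart_frac fi io z x0.
have [r [g [a [gO aO wE]]]] := wc Pc.
have fTd p : is_derivation f (fun a => T p (f a)).
  by have [TA TM] := Td p; split=> b c; rewrite ?rmorphD ?rmorphM ?TA ?TM.
have fT0 p c : T p (f (i c)) = 0 by rewrite fi T0.
rewrite (pullback_form F0 taun taub B0 fTd fT0 wE).
have r0 := regular0 cst t io z; have r1 := regular1 cst t io z.
apply: (big_ind (regular_at cst t io z)) => // [b c|l _]; first exact: regularD.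
apply: regularM => //; first exact: Py.
apply: (big_ind (regular_at cst t io z)) => // [b c|h _]; first exact: regularM.
apply: (big_ind (regular_at cst t io z)) => // [b c|s _]; first exact: regularD.
apply: regularM => //.
  by case: (odd_perm s); rewrite ?expr0 // expr1 -sub0r; apply: regularB.
apply: (big_ind (regular_at cst t io z)) => // [b c|p _]; first exact: regularM.
rewrite mxE; apply: (regular_derivation chart_inj (D := T p)) => //.
by apply: Py; apply: aO.
Qed.

End Regularity.

Section InverseChart.
Variables (E M : fieldType) (cst : {rmorphism E -> M}) (t : M).
Local Notation chart := (eval_poly cst t).
Local Notation chartV := (eval_poly cst t^-1).
Hypothesis chart_inj : forall p, chart p = 0 -> p = 0.
Hypothesis chart_frac : forall a, a \in fractions chart.

Lemma coordinate_neq0 : t != 0.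
Proof.
by rewrite -(eval_polyX cst t); apply: chart_neq0 => //; rewrite polyX_eq0.
Qed.

Lemma extend_derivation (d : E -> E) (c : M) : is_derivation idfun d ->
  exists D : M -> M, [/\ is_derivation idfun D, forall e, D (cst e) = cst (d e) & D t = c].
Proof.
move=> [dA dM]; have [g gE] : exists g : {rmorphism E -> dual M}, forall e, g e = (cst e, cst (d e)).
  apply: (derivation_dual (f := cst)).
  by split=> a b; rewrite ?dA ?dM ?rmorphD ?rmorphM.
have f1 (q : {poly E}) : (eval_poly g (t, c) q).1 = chart q.
  by apply: (dual_eval1 (s := cst)) => e; rewrite gE.
have cf : compatible chart (eval_poly g (t, c)) by move=> p /chart_inj ->; rewrite rmorph0.
have [h [h1 hE]] := dual_fractions f1 cf chart_frac.
exists (fun a => (h a).2); split; first exact: (dual_derivation (f := idfun)).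
  by move=> e; rewrite -(eval_polyC cst t) hE eval_polyC gE.
by rewrite -{1}(eval_polyX cst t) hE eval_polyX.
Qed.

(** [t ^+ size p * p.[t^-1]]: the exponents are [size p - a], all positive. *)
Definition reverse_poly (p : {poly E}) : {poly E} :=
  \sum_(a < size p) p`_a *: 'X^(size p - a).

Lemma chart_reverse p : chart (reverse_poly p) = t ^+ size p * chartV p.
Proof.
rewrite /reverse_poly rmorph_sum eval_polyE horner_coef size_map_poly mulr_sumr.
apply: eq_bigr => a _; rewrite -mul_polyC rmorphM rmorphXn eval_polyC eval_polyX coef_map.
rewrite mulrCA; congr (_ * _).
have -> : t ^+ size p = t ^+ (size p - a) * t ^+ a.
  by rewrite -exprD subnK // ltnW.
rewrite -mulrA.
by rewrite exprVn mulfV ?mulr1 // expf_neq0 // coordinate_neq0.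
Qed.

Lemma size_reverse p : (size (reverse_poly p) <= (size p).+1)%N.
Proof.
apply: leq_trans (size_sum _ _ _) _; apply/bigmax_leqP => a _.
by apply: leq_trans (size_scale_leq _ _) _; rewrite size_polyXn ltnS leq_subr.
Qed.

Lemma reverse_eq0 p : reverse_poly p = 0 -> p = 0.
Proof.
move=> e; apply/polyP => b; rewrite coef0; have [sb|sb] := leqP (size p) b.
  by rewrite nth_default.
have := congr1 (fun q : {poly E} => q`_(size p - b)) e; rewrite coef0 coef_sum.
rewrite (bigD1 (Ordinal sb)) //= coefZ coefXn eqxx mulr1 big1 ?addr0 // => a ab.
rewrite coefZ coefXn; case: eqP => [h|_]; last by rewrite mulr0.
case/eqP: ab; apply: val_inj => /=; have := ltn_ord a; lia.
Qed.

Lemma chartV_inj p : chartV p = 0 -> p = 0.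
Proof.
by move=> e; apply: reverse_eq0; apply: chart_inj; rewrite chart_reverse e mulr0.
Qed.

Lemma chartV_frac a : a \in fractions chartV.
Proof.
have hS := fractions_divring chartV.
apply: (fractions_min hS _ (chart_frac a)) => p.
have [K [u uP]] := ex_subfield hS.
have uin y : u y \in fractions chartV by apply/uP; exists y.
elim/poly_ind: p => [|p c /uP[y ey]]; first by rewrite rmorph0 -(rmorph0 u).
have /uP[yt et] : t^-1 \in fractions chartV.
  by rewrite -{1}(eval_polyX cst t^-1); apply: fractions_image.
have /uP[yc ec] : cst c \in fractions chartV.
  by rewrite -(eval_polyC cst t^-1); apply: fractions_image.
have tE : t = (u yt)^-1 by rewrite -et invrK.
rewrite rmorphD rmorphM eval_polyX eval_polyC ey ec [X in _ * X + _]tE.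
by rewrite -fmorphV -rmorphM -rmorphD uin.
Qed.

(** A form of weight [m] without poles at finite distance has a pole of order at
    least [2 m] at infinity, as the canonical bundle of the line has degree [-2]. *)
Lemma no_form_on_line (m : nat) (A B : {poly E}) : (0 < m)%N -> A != 0 ->
  chartV B = (- t ^+ 2) ^+ m * chart A -> False.
Proof.
move=> m0 A0 e.
have : reverse_poly B = (-1) ^+ m *: ('X^(m * 2 + size B) * A).
  apply/eqP; rewrite -subr_eq0; apply/eqP/chart_inj.
  rewrite rmorphB chart_reverse e -mul_polyC !rmorphM eval_polyC !rmorphXn eval_polyX.
  rewrite rmorphN1 -[- t ^+ 2]mulN1r exprMn -exprM addnC exprD (mulnC 2).
  by rewrite -!mulrA [t ^+ size B * _]mulrCA subrr.
move/(congr1 (fun q : {poly E} => size q)) => es.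
have := size_reverse B; rewrite es size_scale ?signr_eq0 // size_monicM ?monicXn //.
rewrite size_polyXn; have : (0 < size A)%N by rewrite size_poly_gt0.
have aux b a : (0 < a -> ((m * 2 + b).+1 + a).-1 <= b.+1 -> False)%N by lia.
by move=> h1 h2; apply: aux h1 h2.
Qed.

End InverseChart.

Section LineBasis.
Variables (k E M : fieldType) (j : {rmorphism k -> E}) (cst : {rmorphism E -> M}) (t : M).
Hypothesis chart_inj : forall p, eval_poly cst t p = 0 -> p = 0.
Hypothesis chart_frac : forall a, a \in fractions (eval_poly cst t).

Lemma mmap_nth_map n (s : seq E) (sn : size s = n) p :
  mmap (cst \o j) (fun l : 'I_n => (map cst s)`_l) p =
  cst (mmap j (fun l : 'I_n => s`_l) p).
Proof.
rewrite rmorph_mmap; congr (mmap _ _ p); apply/funext => a.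
by rewrite /= (nth_map 0) // sn.
Qed.

Lemma free_map s : free j s -> free (cst \o j) (map cst s).
Proof.
move=> fs; apply/(free_mmap _ (size_map _ s)) => p; rewrite mmap_nth_map //.
by move/eqP; rewrite fmorph_eq0 => /eqP/fs.
Qed.

Lemma dep_map s a : dep j s a -> dep (cst \o j) (map cst s) (cst a).
Proof.
move=> [P P0 Pa]; apply/(dep_mmap _ (size_map _ s)).
have mE : map_poly (mmap (cst \o j) (fun l : 'I_(size s) => (map cst s)`_l)) P =
    map_poly cst (map_poly (ev j s) P).
  by rewrite -map_poly_comp; apply: eq_map_poly => p; apply: mmap_nth_map.
exists P; first by rewrite mE map_poly_eq0.
rewrite eval_polyE /= mE -[cst a]/(cst a) horner_map.
by have := Pa; rewrite eval_polyE => ->; rewrite rmorph0.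
Qed.

Lemma line_basis s : transcendence_basis j s ->
  transcendence_basis (cst \o j) (t :: map cst s).
Proof.
move=> [fs ds]; split.
  apply/freeP; split; first exact: free_map.
  move=> d; have [P P0 Pt] : algebraic cst t.
    apply: algebraic_trans d => p.
    have /fractionsP[a [b [b0 ->]]] : ev (cst \o j) (map cst s) p \in fractions cst.
      apply: mmap_in; first exact: fractions_divring.
        by move=> c; apply: fractions_image.
      by move=> l; rewrite (nth_map 0) ?fractions_image // -(size_map cst).
    by rewrite -fmorph_div; apply: algebraic_image.
  by move: P0; rewrite (chart_inj Pt) rmorph0 eqxx.
move=> a; apply/asboolP.
apply: (fractions_min (algebraic_divring (ev (cst \o j) (t :: map cst s))) _ (chart_frac a)) => p.
have hS := algebraic_divring (ev (cst \o j) (t :: map cst s)).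
have [K [u uP]] := ex_subfield hS.
apply/uP; elim/poly_ind: p => [|p c [y ey]]; first by exists 0; rewrite !rmorph0.
have [yt et] : exists x, t = u x by apply/uP/asboolP/dep_mem; rewrite mem_head.
have [yc ec] : exists x, cst c = u x.
  apply/uP/asboolP; apply: dep_sub (dep_map (ds c)) => x xs.
  by rewrite inE xs orbT.
exists (y * yt + yc).
by rewrite !rmorphD !rmorphM eval_polyX eval_polyC ey -et -ec.
Qed.

End LineBasis.

Lemma derivation_inv (M : fieldType) (G : M -> M) t : is_derivation idfun G -> t != 0 ->
  G t^-1 = - (t ^+ 2)^-1 * G t.
Proof.
move=> [_ GM] t0; have G1 : G 1 = 0.
  by have e := GM 1 1; apply: (addrI (G 1)); rewrite addr0 -[in RHS](mulr1 1) e /= !mul1r.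
apply: (mulfI t0); have := GM t t^-1; rewrite mulfV // G1 => /esym/eqP.
rewrite addr_eq0 => /eqP /= ->; rewrite -mulNr mulrA; congr (_ * _).
by rewrite mulrN expr2 invfM mulrA mulfV // mul1r.
Qed.

(** A combination of the [T p] that kills the image of [tau] is zero on [M], which
    is algebraic over this image by equality of transcendence degrees. *)
Lemma frame_restriction (k F M : fieldType) (i : {rmorphism k -> F})
    (u : {rmorphism k -> M}) (f : {rmorphism F -> M}) n (tau : seq F) (T : 'I_n -> M -> M) (b : seq M) :
  char0 M -> size tau = n -> transcendence_basis i tau ->
  (forall c, f (i c) = u c) -> transcendence_basis u b -> size b = n ->
  (forall p, is_derivation idfun (T p)) -> (forall p c, T p (u c) = 0) ->
  (forall v : 'I_n -> M, (forall a, \sum_p v p * T p a = 0) -> forall p, v p = 0) ->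
  \det (\matrix_(p, q) T p (f tau`_q)) != 0.
Proof.
move=> M0 taun [ftau _] fi bb bn Td T0 Tind; apply/negP => /det0P[v v0 vT].
have bt : transcendence_basis u (map f tau).
  have fm : free u (map f tau).
    move=> p; have <- : ev (f \o i) (map f tau) p = ev u (map f tau) p.
      by rewrite /ev /=; congr (mmap _ _ p); apply/funext.
    exact: free_map.
  by apply: (free_basis bb fm); rewrite size_map taun bn.
case/eqP: v0; apply/rowP => p; rewrite mxE; apply: (Tind (fun p => v 0 p)) => a.
apply: (derivation_alg_zero (f := idfun) (i := u) (s := map f tau)
  (D := fun a => \sum_p v 0 p * T p a)) M0 _ _ _ (proj2 bt) a.
- exact: derivation_sum.
- by move=> c; apply: big1 => q _; rewrite T0 mulr0.
- move=> _ /(nthP 0)[q qs <-]; rewrite size_map taun in qs.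
  have := congr1 (fun u : 'rV[M]_n => u 0 (Ordinal qs)) vT; rewrite !mxE => e.
  rewrite (nth_map 0) ?taun //= -[RHS]e; apply: eq_bigr => s _.
  by rewrite mxE.
Qed.

(** The factor [g] accounts for the change of coordinate on the line: it is [1] for
    [t] and [- t ^ 2] for the inverse of [t]. *)
Section LineFrame.
Variables (E M : fieldType) (n : nat) (dt : M -> M) (de : 'I_n -> M -> M).

Definition line_frame (g : M) (p : 'I_n.+1) (a : M) : M :=
  if unlift ord0 p is Some b then de b a else g * dt a.

Lemma line_frame0 g a : line_frame g ord0 a = g * dt a.
Proof. by rewrite /line_frame unlift_none. Qed.

Lemma line_frameS g b a : line_frame g (lift ord0 b) a = de b a.
Proof. by rewrite /line_frame liftK. Qed.

Lemma line_frame_det g (y : 'I_n.+1 -> M) :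
  \det (\matrix_(p, q) line_frame g p (y q)) =
  g * \det (\matrix_(p, q) line_frame 1 p (y q)).
Proof.
pose d : 'rV[M]_n.+1 := \row_p (if p == ord0 then g else 1).
have -> : \matrix_(p, q) line_frame g p (y q) =
    diag_mx d *m \matrix_(p, q) line_frame 1 p (y q).
  apply/matrixP => p q; rewrite mul_diag_mx !mxE.
  by case: (unliftP ord0 p) => [b|] ->; rewrite ?line_frame0 ?line_frameS ?eqxx ?mul1r.
rewrite det_mulmx det_diag big_ord_recl mxE eqxx big1 ?mulr1 // => b _.
by rewrite mxE.
Qed.

Lemma line_frame_derivation g : is_derivation idfun dt ->
  (forall b, is_derivation idfun (de b)) -> forall p, is_derivation idfun (line_frame g p).
Proof.
move=> [tA tM] dd p; case: (unliftP ord0 p) => [b|] ->; split=> x y;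
  rewrite ?line_frameS ?line_frame0; try by case: (dd b).
  by rewrite tA mulrDr.
by rewrite tM mulrDr !(mulrCA g).
Qed.

End LineFrame.

Section DominantLine.
Variables (k : closedFieldType) (kinf : infinite_field k).
Variables (F E M : fieldType) (i : {rmorphism k -> F}) (j : {rmorphism k -> E}).
Variables (cst : {rmorphism E -> M}) (t : M) (f : {rmorphism F -> M}).
Hypothesis inj : forall p, eval_poly cst t p = 0 -> p = 0.
Hypothesis frac : forall a, a \in fractions (eval_poly cst t).
Hypothesis fi : forall c, f (i c) = cst (j c).
Hypotheses (F0 : char0 F) (E0 : char0 E).
Variables (l e : seq E) (lgen : field_generators j l) (eb : transcendence_basis j e).
Variables (tau : seq F) (taun : size tau = (size e).+1).
Variables (taub : transcendence_basis i tau).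
Variables (N m : nat) (x : 'I_N.+1 -> F) (x0 : exists l, x l != 0) (m0 : (0 < m)%N).
Variables (w : rational_form i (size e).+1) (wc : pluricanonical x m w).

(** The two polynomials [A] and [B] are the pull-back of the form in the charts
    [t] and [1 / t]; they contradict [no_form_on_line]. *)
Theorem no_pluricanonical_form (D : 'I_(size e).+1 -> derivation i) : w D = 0.
Proof.
apply: contrapT => /eqP wD; have M0 : char0 M := char0_extension cst E0.
have injV := chartV_inj inj; have fracV := chartV_frac frac.
have [d dE] := choice (fun b => partial_derivation b E0 lgen eb).
have dd b : is_derivation idfun (d b) by case: (dE b).
have [de deE] := choice (fun b => extend_derivation inj frac 0 (dd b)).
have zd : is_derivation idfun (fun _ : E => 0 : E).
  by split=> a b; rewrite ?addr0 // !mulr0 addr0.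
have [dt [dtd dtc dtt]] := extend_derivation inj frac 1 zd.
pose T g := line_frame dt de g.
have Td g p : is_derivation idfun (T g p).
  by apply: line_frame_derivation => // b; case: (deE b).
have Tconst g p c : T g p (cst (j c)) = 0.
  rewrite /T; case: (unliftP ord0 p) => [b|] ->; rewrite ?line_frameS ?line_frame0.
    by have [_ -> _] := deE b; have [_ -> _] := dE b; rewrite rmorph0.
  by rewrite dtc rmorph0 mulr0.
have t0 : t != 0 := coordinate_neq0 inj.
have T1c p q : exists r, T 1 p (eval_poly cst t q) = eval_poly cst t r.
  case: (unliftP ord0 p) => [b|] ->.
    apply: (chart_derivation (d := d b) (c := 0) (Td 1 _)) => [a|];
      rewrite /T line_frameS; have [_ ec et] := deE b; first exact: ec.
    by rewrite et rmorph0.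
  apply: (chart_derivation (d := fun _ => 0) (c := 1) (Td 1 _)) => [a|];
    rewrite /T line_frame0 mul1r ?dtc // dtt rmorph1.
  by [].
have TVc p q : exists r, T (- t ^+ 2) p (eval_poly cst t^-1 q) = eval_poly cst t^-1 r.
  case: (unliftP ord0 p) => [b|] ->.
    apply: (chart_derivation (d := d b) (c := 0) (Td _ _)) => [a|];
      rewrite /T line_frameS; have [ed ec et] := deE b; first exact: ec.
    by rewrite derivation_inv // et mulr0 rmorph0.
  apply: (chart_derivation (d := fun _ => 0) (c := 1) (Td _ _)) => [a|];
    rewrite /T line_frame0 ?dtc ?rmorph0 ?mulr0 // rmorph1 derivation_inv // dtt mulr1.
  by rewrite mulrNN mulfV // expf_neq0.
have [a wa] : exists a, wedge_diff a D != 0.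
  have [P [Pc _]] := place_closed_point kinf inj frac fi (idfun : {rmorphism E -> E}) 0 x0.
  have [r [g [a [_ _ wE]]]] := wc Pc.
  apply: contrapT => na; case/eqP: wD; rewrite wE big1 // => s _.
  rewrite (bigD1 (Ordinal m0)) //= (_ : wedge_diff _ _ = 0) ?mul0r ?mulr0 //.
  by apply: contrapT => /eqP h; apply: na; exists (a s (Ordinal m0)).
have B0 := frame_det F0 taun taub wa.
have [A eA] := pullback_polynomial kinf inj frac fi F0 taun taub B0 (Td 1) (Tconst 1) T1c x0 wc.
have [B eB] := pullback_polynomial kinf injV fracV fi F0 taun taub B0
  (Td (- t ^+ 2)) (Tconst (- t ^+ 2)) TVc x0 wc.
have A0 : A != 0.
  have : eval_poly cst t A != 0; last by apply: contraNneq => ->; rewrite rmorph0.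
  rewrite -eA mulf_neq0 ?fmorph_eq0 // expf_neq0 //.
  rewrite /frame_ratio mulf_neq0 ?invr_eq0 ?fmorph_eq0 //.
  have bM := line_basis inj frac eb.
  apply: (frame_restriction M0 taun taub (u := cst \o j) fi bM) => //.
    by rewrite /= size_map.
    exact: (Tconst 1).
  move=> v vT p.
  have v0 : v ord0 = 0.
    have := vT t; rewrite big_ord_recl /T line_frame0 dtt !mulr1 big1 ?addr0 // => b _.
    by rewrite line_frameS; have [_ _ ->] := deE b; rewrite mulr0.
  case: (unliftP ord0 p) => [b|] -> //.
  have := vT (cst e`_b); rewrite big_ord_recl v0 mul0r add0r.
  rewrite (bigD1 b) //= /T line_frameS; have [_ -> _] := deE b; have [_ _ ->] := dE b.
  rewrite eqxx rmorph1 mulr1 big1 ?addr0 // => b' nb.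
  rewrite line_frameS; have [_ -> _] := deE b'; have [_ _ ->] := dE b'.
  by rewrite eq_sym (negPf nb) rmorph0 mulr0.
apply: (no_form_on_line inj m0 A0 (B := B)).
rewrite -eA -eB mulrA -exprMn; congr (_ ^+ _ * _).
by rewrite /frame_ratio line_frame_det mulrA.
Qed.

End DominantLine.

Theorem uniruled_kodaira (k : closedFieldType) (F : fieldType) (i : {rmorphism k -> F}) :
  infinite_field k -> [pchar k] =i pred0 -> uniruled i -> nonneg_kodaira_dim i -> False.
Proof.
move=> kinf k0 [E [j [n' [[l lgen] trE trF [f _ fi]]]]].
move=> [_ [n [N [x [trn [[x0 _] _] [[m [m0 [w [wc [D wD]]] _]] _]]]]]].
have nE := trdeg_uniq trn trF; subst n.
have /has_trdegP[e [en eb]] := trE; have /has_trdegP[tau [taun taub]] := trF.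
subst n'.
have chartE p : eval_poly (rational_const E) (tofrac 'X) p = tofrac p.
  move: p; apply: (poly_rmorph_ext (g := @tofrac {poly E})) => [c|].
    by rewrite eval_polyC.
  by rewrite eval_polyX.
have kc0 : char0 k by move=> h; move/pcharf0P: k0 => ->.
case/eqP: wD; apply: (no_pluricanonical_form (t := tofrac 'X) kinf _ _ fi _ _ lgen eb taun taub x0 m0 wc).
- by move=> p; rewrite chartE => /eqP; rewrite tofrac_eq0 => /eqP.
- move=> a; have [p [q [q0 ->]]] := frac_div a; apply/fractionsP; exists p, q.
  by rewrite !chartE tofrac_eq0.
- exact: char0_extension i kc0.
- exact: char0_extension j kc0.
Qed.

Lemma uncountable_infinite (k : fieldType) : ~ countable [set: k] -> infinite_field k.
Proof.
move=> kunc; have kinf : infinite_set [set: k].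
  by move=> kfin; apply: kunc; apply: finite_set_countable.
move/infiniteP: kinf => le; have [h] := card_leP le.
pose e (n : nat) : set_type [set: nat]%classic := SigSub (mem_setT n).
exists (fun n => set_val (h (e n))) => a b /val_inj ab.
by have /(congr1 set_val) := inj (mem_setT (e a)) (mem_setT (e b)) ab.
Qed.

Local Open Scope classical_set_scope.
Unset Implicit Arguments.

Theorem corollary2p9 (R : realType) (k : closedFieldType)
    (hk : ~ countable [set: k])
    (A : algType k) (hfg : fg_algebra A) (hprime : prime_algebra A)
    (hgoldie : left_goldie A) (hGK : (GKdim A R < +oo)%E)
    (hcentre : fg_algebra (centre_alg A)) :
  (~ strongly_cancellative A -> uniruled (frac_centre_scalar hprime)) /\
  ([pchar k] =i pred0 -> nonneg_kodaira_dim (frac_centre_scalar hprime) ->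
   strongly_cancellative A).
Proof.
have kinf := uncountable_infinite hk.
have uni := not_cancellative_uniruled hprime kinf hcentre.
split=> [|k0 kod]; first exact: uni.
apply: contrapT => nsc.
exact: uniruled_kodaira kinf k0 (uni nsc) kod.
Qed.
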